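(* For all $z\in\mathbb{C}\setminus\{0\}$ with $|\arg z|<\pi$, $$\frac{W(z)}{z}=\beta_0+\frac{1}{\pi}\int_0^\pi K(z,v)\,dv$$ and $$\frac{z}{W(z)}=\eta_0-\frac{1}{\pi}\int_0^\pi K(z,v)\,e^{-2v\cot v}\,dv ,$$ where $$K(z,v)=\frac{\left(1+z\,t(v)\right)\left(v^2+(1-v\cot v)^2\right)}{\left(z-t(v)\right)\left(1+t^2(v)\right)},\qquad t(v)=-v\csc(v)\,e^{-v\cot v},$$ $\beta_0=\operatorname{Re}\left[W(i)/i\right]=\operatorname{Im}W(i)$ (numerically $0.5764127\ldots$) and $\eta_0=\operatorname{Re}\left[i/W(i)\right]$ (numerically $1.21953\ldots$).
   Context: $W$ denotes the principal branch of the Lambert $W$ function: the unique holomorphic function on $\mathbb{C}\setminus(-\infty,-1/e]$ with $W(z)e^{W(z)}=z$ and $W(0)=0$. $|\arg z|<\pi$ means $z\in\mathbb{C}\setminus(-\infty,0]$. $t^2(v)$ means $(t(v))^2$. *)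

(* Defs.v *)
From Stdlib Require Import Reals.
From Coquelicot Require Import Coquelicot.

Local Open Scope R_scope.

Definition Cexp (z : C) : C :=
  (exp (Re z) * cos (Im z), exp (Re z) * sin (Im z)).

(* The complex plane cut along the real half-line (-oo, a]. *)
Definition cut_plane (a : R) (z : C) : Prop := ~ (Im z = 0 /\ Re z <= a).

(* Only the values on the cut plane are constrained: [W] is arbitrary on the
   cut. The first clause is complex differentiability, i.e. holomorphy, since
   [cut_plane a] is open. *)
Definition principal_LambertW (W : C -> C) : Prop :=
  (forall z : C, cut_plane (-1 / exp 1) z ->
     ex_derive (K := C_AbsRing) (V := C_NormedModule) W z) /\
  (forall z : C, cut_plane (-1 / exp 1) z -> (W z * Cexp (W z))%C = z) /\
  W (RtoC 0) = RtoC 0.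

Definition cot (v : R) : R := cos v / sin v.
Definition csc (v : R) : R := / sin v.

Definition t (v : R) : R := - v * csc v * exp (- v * cot v).

(* At [v = 0] and [v = PI], where [sin v = 0], the value of [K z v] is an
   artefact of total division; it does not affect integrals over [0, PI]. *)
Definition K (z : C) (v : R) : C :=
  (((1 + z * t v) * RtoC (v ^ 2 + (1 - v * cot v) ^ 2)%R)
   / ((z - t v) * RtoC (1 + (t v) ^ 2)%R))%C.

(* Main.v *)
Require Import Defs.
From Stdlib Require Import Reals Lra Lia Psatz Arith.
From Coquelicot Require Import Coquelicot.

Local Open Scope R_scope.

(** Put zeta(w) = w e^w and g(w) = e^(sg w) with sg = -1 or sg = 1, so that
    g(W(z)) is W(z)/z or z/W(z). Both formulas are one Cauchy formula for
    g(W(z)), written in the w-plane, where every function is explicit.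

    The principal branch maps the plane cut along (-oo, -1/e] onto the domain
    |Im w| < PI, Re w > - v cot v (v = Im w): along a ray from 0, W(z) cannot
    meet the boundary, since zeta is real there and runs along the cut, with
    zeta(- v cot v + i v) = t(v) ([LambertW_lambert_domain]). On this domain
    zeta is injective ([zeta_inj_lambert_domain]), so zeta - zeta(p) vanishes
    only at p and
      zeta'(w) (g(w) - g(p)) / (zeta(w) - zeta(p))
    has a removable singularity at p. Cauchy's theorem moves its integral from
    the boundary curve to the vertical line Re w = R through the points
    - b cot b +- i b where R = - b cot b ([Cauchy_one_pole]). On the curve the
    two edges of the cut carry the same t'(v) and t(v) - zeta(p), so that g(p)
    cancels and only 2 i Im g(- v cot v + i v) t'(v) / (t(v) - zeta(p)) is left
    ([boundary_jump]); here v t'/t = v^2 + (1 - v cot v)^2.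

    Add the identities for p = W(z), W(i) and the conjugate of W(i) with
    weights 1, -1/2, -1/2. The boundary integrand becomes the kernel K, because
    1/(t-z) - (1/(t-i) + 1/(t+i))/2 = (1 + z t)/((t-z)(1+t^2)) ([jump_sum]).
    As b tends to PI the abscissa R tends to infinity, and since the weights
    sum to 0 the integrand on the vertical segment, of length 2 b, tends
    uniformly to - (g(W(z)) - Re g(W(i))) ([kernel_integral_re]). The limit is
    the representation, with Re g(W(i)) equal to beta0 or eta0; the integrals
    over [0, PI] exist because the integrands extend continuously to both end
    points ([K_ext_continuous]).

    For the decimals, W(i) = u + i v satisfies u = v tan v and
    v e^(v tan v) = cos v; the first side increases and the second decreases,
    so Taylor bounds at two decimal numbers enclose v ([W_Ci_bounds]). *)

(** * Calculus of complex-valued functions of real parameters *)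

(** Continuity is read on the coordinates, so that the real continuity lemmas
    apply whatever the domain is: R, R * R for two parameters, or an arbitrary
    uniform space. *)
Definition Ccont {T : UniformSpace} (f : T -> C) (x : T) : Prop :=
  continuous (fun y => Re (f y)) x /\ continuous (fun y => Im (f y)) x.

Definition Cder (f : R -> C) (x : R) (l : C) : Prop :=
  is_derive (fun y => Re (f y)) x (Re l) /\ is_derive (fun y => Im (f y)) x (Im l).

Lemma continuous_real_comp {T : UniformSpace} (h : R -> R) (f : T -> R) x :
  continuous f x -> ex_derive h (f x) -> continuous (fun y => h (f y)) x.
Proof.
  intros Hf Hh. apply (continuous_comp f h); [exact Hf|].
  apply (ex_derive_continuous (V := R_NormedModule)). exact Hh.
Qed.

Lemma Ccont_const {T : UniformSpace} (k : C) (x : T) : Ccont (fun _ => k) x.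
Proof. split; apply continuous_const. Qed.

Lemma Ccont_plus {T : UniformSpace} (f g : T -> C) x :
  Ccont f x -> Ccont g x -> Ccont (fun y => (f y + g y)%C) x.
Proof.
  intros [f1 f2] [g1 g2]; split;
    apply (continuous_plus (V := R_NormedModule)); assumption.
Qed.

Lemma Ccont_opp {T : UniformSpace} (f : T -> C) x :
  Ccont f x -> Ccont (fun y => (- f y)%C) x.
Proof.
  intros [f1 f2]; split; apply (continuous_opp (V := R_NormedModule)); assumption.
Qed.

Lemma Ccont_mult {T : UniformSpace} (f g : T -> C) x :
  Ccont f x -> Ccont g x -> Ccont (fun y => (f y * g y)%C) x.
Proof.
  intros [f1 f2] [g1 g2]; split.
  - apply (continuous_minus (V := R_NormedModule));
      apply (continuous_mult (K := R_AbsRing)); assumption.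
  - apply (continuous_plus (V := R_NormedModule));
      apply (continuous_mult (K := R_AbsRing)); assumption.
Qed.

Lemma Cnorm2_neq_0 (z : C) : z <> 0 -> Re z ^ 2 + Im z ^ 2 <> 0.
Proof.
  intros Hz H. apply Hz. destruct z as [a b]; simpl in *.
  assert (a = 0) by nra. assert (b = 0) by nra. subst. reflexivity.
Qed.

Lemma Ccont_inv {T : UniformSpace} (f : T -> C) x :
  f x <> 0 -> Ccont f x -> Ccont (fun y => (/ f y)%C) x.
Proof.
  intros H0 [f1 f2]. apply Cnorm2_neq_0 in H0.
  assert (Hi : continuous (fun y => / (Re (f y) ^ 2 + Im (f y) ^ 2)) x).
  { apply (continuous_real_comp Rinv (fun y => Re (f y) ^ 2 + Im (f y) ^ 2)).
    - apply (continuous_plus (V := R_NormedModule)).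
      + apply (continuous_real_comp (fun u => u ^ 2)); [exact f1|auto_derive; trivial].
      + apply (continuous_real_comp (fun u => u ^ 2)); [exact f2|auto_derive; trivial].
    - auto_derive; exact H0. }
  split.
  - apply (continuous_mult (K := R_AbsRing)); assumption.
  - apply (continuous_mult (K := R_AbsRing) (fun y => - Im (f y))); [|assumption].
    apply (continuous_opp (V := R_NormedModule)); assumption.
Qed.

Lemma Ccont_exp {T : UniformSpace} (f : T -> C) x :
  Ccont f x -> Ccont (fun y => Cexp (f y)) x.
Proof.
  intros [f1 f2]; split;
    apply (continuous_mult (K := R_AbsRing) (fun y => exp (Re (f y)))).
  1,3: apply (continuous_real_comp exp); [assumption|auto_derive; trivial].
  - apply (continuous_real_comp cos); [assumption|auto_derive; trivial].
  - apply (continuous_real_comp sin); [assumption|auto_derive; trivial].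
Qed.

Lemma Cder_const (k : C) x : Cder (fun _ => k) x 0.
Proof. split; apply (is_derive_const (V := R_NormedModule)). Qed.

Lemma Cder_plus f g x l m : Cder f x l -> Cder g x m ->
  Cder (fun y => (f y + g y)%C) x (l + m)%C.
Proof.
  intros [f1 f2] [g1 g2]; split; apply (is_derive_plus (V := R_NormedModule)); assumption.
Qed.

Lemma is_derive_eq (f : R -> R) x l m : is_derive f x l -> l = m -> is_derive f x m.
Proof. intros H <-. exact H. Qed.

Lemma Cder_eq f x l m : Cder f x l -> l = m -> Cder f x m.
Proof. intros H <-. exact H. Qed.

Lemma Cder_mult f g x l m : Cder f x l -> Cder g x m ->
  Cder (fun y => (f y * g y)%C) x (l * g x + f x * m)%C.
Proof.
  intros [f1 f2] [g1 g2]; split; simpl.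
  - eapply is_derive_eq.
    + apply (is_derive_minus (V := R_NormedModule));
        apply (is_derive_mult (K := R_AbsRing)); try eassumption; apply Rmult_comm.
    + unfold minus, plus, opp, mult; simpl. unfold Re, Im. ring.
  - eapply is_derive_eq.
    + apply (is_derive_plus (V := R_NormedModule));
        apply (is_derive_mult (K := R_AbsRing)); try eassumption; apply Rmult_comm.
    + unfold plus, mult; simpl. unfold Re, Im. ring.
Qed.

Lemma Cder_inv (f : R -> C) x l : f x <> 0 -> Cder f x l ->
  Cder (fun y => (/ f y)%C) x (- l / (f x * f x))%C.
Proof.
  intros H0 [f1 f2]. apply Cnorm2_neq_0 in H0.
  assert (Hn : (Re (f x) * Re (f x) - Im (f x) * Im (f x)) ^ 2
     + (Re (f x) * Im (f x) + Im (f x) * Re (f x)) ^ 2 <> 0).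
  { replace (_ + _) with ((Re (f x) ^ 2 + Im (f x) ^ 2) ^ 2) by ring.
    apply pow_nonzero; exact H0. }
  assert (H : forall u v : R -> R, is_derive u x (Re l) -> is_derive v x (Im l) ->
     u x ^ 2 + v x ^ 2 <> 0 ->
     is_derive (fun y => u y / (u y ^ 2 + v y ^ 2)) x
       (Re l / (u x ^ 2 + v x ^ 2) -
          u x * (2 * u x * Re l + 2 * v x * Im l) / (u x ^ 2 + v x ^ 2) ^ 2)).
  { intros u v hu hv h. auto_derive.
    - repeat split; try assumption; eexists; eassumption.
    - rewrite (is_derive_unique (fun y : R => u y) _ _ hu), (is_derive_unique (fun y : R => v y) _ _ hv). field. exact h. }
  split.
  - eapply is_derive_eq; [exact (H (fun y => Re (f y)) (fun y => Im (f y)) f1 f2 H0)|].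
    simpl; unfold Re, Im in *; simpl. field; split; intro HH; [apply Hn|apply H0]; rewrite <- HH; ring.
  - apply (is_derive_ext (fun y => - (Im (f y) / (Im (f y) ^ 2 + Re (f y) ^ 2)))).
    { intro y. simpl. unfold Re, Im. rewrite (Rplus_comm (snd (f y) * _)).
      unfold Rdiv. ring. }
    rewrite Rplus_comm in H0.
    assert (H' : forall u v : R -> R, is_derive u x (Im l) -> is_derive v x (Re l) ->
     u x ^ 2 + v x ^ 2 <> 0 ->
     is_derive (fun y => - (u y / (u y ^ 2 + v y ^ 2))) x
       (- (Im l / (u x ^ 2 + v x ^ 2) -
          u x * (2 * u x * Im l + 2 * v x * Re l) / (u x ^ 2 + v x ^ 2) ^ 2))).
    { intros u v hu hv h. auto_derive.
      - repeat split; try assumption; eexists; eassumption.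
      - rewrite (is_derive_unique (fun y : R => u y) _ _ hu), (is_derive_unique (fun y : R => v y) _ _ hv). field. exact h. }
    eapply is_derive_eq; [exact (H' (fun y => Im (f y)) (fun y => Re (f y)) f2 f1 H0)|].
    simpl; unfold Re, Im in *; simpl. field; split; intro HH; [apply Hn|apply H0]; rewrite <- HH; ring.
Qed.

Lemma Cder_exp (f : R -> C) x l :
  Cder f x l -> Cder (fun y => Cexp (f y)) x (l * Cexp (f x))%C.
Proof.
  intros [f1 f2].
  assert (H : forall u v : R -> R, is_derive u x (Re l) -> is_derive v x (Im l) ->
     is_derive (fun y => exp (u y) * cos (v y)) x
       (Re l * exp (u x) * cos (v x) - exp (u x) * sin (v x) * Im l) /\
     is_derive (fun y => exp (u y) * sin (v y)) x
       (Re l * exp (u x) * sin (v x) + exp (u x) * cos (v x) * Im l)).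
  { intros u v hu hv; split; auto_derive;
      try (repeat split; eexists; eassumption);
      rewrite (is_derive_unique (fun y : R => u y) _ _ hu), (is_derive_unique (fun y : R => v y) _ _ hv); ring. }
  destruct (H _ _ f1 f2) as [h1 h2].
  split; (eapply is_derive_eq; [first [apply h1 | apply h2]|]);
    unfold Cexp; simpl; unfold Re, Im; ring.
Qed.

(** * Integrals with a parameter and Cauchy's theorem on horizontal segments *)

(** Continuity at a point, and [hol_at] for holomorphy with derivative [H'], are
    stated through composition with a map or a curve reaching the point. Only
    such composites are ever differentiated or integrated, and the chain rule
    becomes the definition. *)
Definition cont_at (H : C -> C) (w0 : C) : Prop :=
  forall (T : UniformSpace) (w : T -> C) x,
    w x = w0 -> Ccont w x -> Ccont (fun y => H (w y)) x.

Definition hol_at (H H' : C -> C) (w0 : C) : Prop :=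
  forall (w : R -> C) x l,
    w x = w0 -> Cder w x l -> Cder (fun y => H (w y)) x (H' w0 * l)%C.

Lemma Ccont_scal_re {T : UniformSpace} (c : C) (f : T -> C) x :
  Ccont f x -> continuous (fun y => Re (c * f y)%C) x.
Proof. intro Hf. apply (Ccont_mult (fun _ => c) f x); [apply Ccont_const|exact Hf]. Qed.

(** The projection of the line onto [a, b]. Composing with it turns continuity on
    [a, b] into two-sided continuity everywhere. *)
Definition clip (a b x : R) : R := Rmax a (Rmin b x).

Lemma clip_range a b x : a <= b -> a <= clip a b x <= b.
Proof.
  intro H. unfold clip. split; [apply Rmax_l|].
  apply Rmax_lub; [exact H|apply Rmin_l].
Qed.

Lemma clip_id a b x : a <= x <= b -> clip a b x = x.
Proof. intros [H1 H2]. unfold clip. rewrite Rmin_right, Rmax_right; lra. Qed.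

Lemma clip_lip a b x y : Rabs (clip a b y - clip a b x) <= Rabs (y - x).
Proof.
  unfold clip, Rmax, Rmin.
  repeat destruct Rle_dec; unfold Rabs; repeat destruct Rcase_abs; lra.
Qed.

Lemma continuity_2d_pt_snd_cont (f : R -> R -> R) x t :
  continuity_2d_pt f x t -> continuous (f x) t.
Proof.
  intro H. apply continuity_pt_filterlim.
  intros eps Heps. destruct (H (mkposreal eps Heps)) as [d Hd].
  exists d. split; [apply cond_pos|]. intros y [_ Hy]. simpl in *. unfold R_dist in *.
  apply Hd; [|exact Hy]. rewrite Rminus_diag, Rabs_R0. apply cond_pos.
Qed.

(** Uniform continuity on the compact rectangle makes the integrands at nearby
    parameters uniformly close; [clip] keeps the parameter inside the rectangle
    when the end points are approached from outside. *)
Lemma RInt_param_clip_continuous (f : R -> R -> R) a b :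
  a <= b ->
  (forall x t, a <= x <= b -> 0 <= t <= 1 -> continuity_2d_pt f x t) ->
  forall x, continuity_pt (fun y => RInt (f (clip a b y)) 0 1) x.
Proof.
  intros Hab Hf x eps Heps.
  assert (Hint : forall y, ex_RInt (f (clip a b y)) 0 1).
  { intro y. apply (ex_RInt_continuous (V := R_CompleteNormedModule)).
    rewrite Rmin_left, Rmax_right by lra. intros t Ht.
    apply continuity_2d_pt_snd_cont. apply Hf; [apply clip_range; exact Hab|exact Ht]. }
  assert (He : 0 < eps / 2) by lra.
  destruct (uniform_continuity_2d f a b 0 1 Hf (mkposreal _ He)) as [d Hd].
  exists d. split; [apply cond_pos|]. intros y [_ Hy]. simpl in *. unfold R_dist in *.
  rewrite <- (RInt_minus (V := R_CompleteNormedModule)) by apply Hint.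
  apply Rle_lt_trans with (eps / 2); [|lra].
  replace (eps / 2) with ((1 - 0) * (eps / 2)) by ring.
  apply (abs_RInt_le_const (fun t => f (clip a b y) t - f (clip a b x) t));
    [lra| |].
  - apply (ex_RInt_minus (V := R_NormedModule)); apply Hint.
  - intros t Ht. apply Rlt_le. apply Hd; try apply clip_range; try assumption.
    + eapply Rle_lt_trans; [apply clip_lip|exact Hy].
    + rewrite Rminus_diag, Rabs_R0. apply cond_pos.
Qed.

Lemma clip_continuous a b x : continuous (clip a b) x.
Proof.
  apply continuity_pt_filterlim. intros eps Heps. exists eps. split; [exact Heps|].
  intros y [_ Hy]. simpl in *. unfold R_dist in *.
  eapply Rle_lt_trans; [apply clip_lip|exact Hy].
Qed.

(** At the end points only continuity of the primitive is required. This matters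
    because v cot v is differentiated on the open interval only. *)
Lemma RInt_derive_open (P f : R -> R) a b :
  a <= b ->
  (forall x, a <= x <= b -> continuity_pt P x) ->
  (forall x, a <= x <= b -> continuous f x) ->
  (forall x, a < x < b -> is_derive P x (f x)) ->
  RInt f a b = P b - P a.
Proof.
  intros Hab HP Hf HD.
  (* [g] agrees with [f] on the interval and is continuous on the whole line *)
  set (g := fun x => f (clip a b x)).
  assert (Hg : forall x, continuous g x).
  { intro x. apply (continuous_comp (clip a b) f); [apply clip_continuous|].
    apply Hf, clip_range, Hab. }
  rewrite (RInt_ext f g).
  2: { intros x Hx. rewrite Rmin_left, Rmax_right in Hx by lra. unfold g.
       rewrite clip_id; [reflexivity|lra]. }
  assert (HG : forall x, is_derive (fun y => RInt g a y) x (g x)).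
  { intro x. apply (is_derive_RInt (V := R_NormedModule) g _ a).
    - apply filter_forall. intro y. apply (RInt_correct (V := R_CompleteNormedModule)).
      apply (ex_RInt_continuous (V := R_CompleteNormedModule)). intros; apply Hg.
    - apply Hg. }
  destruct (MVT_gen (fun x => P x - RInt g a x) a b (fun _ => 0)) as [c [_ Hc]].
  - rewrite Rmin_left, Rmax_right by lra. intros x Hx.
    eapply is_derive_eq.
    + apply (is_derive_minus (V := R_NormedModule)); [apply HD, Hx|apply HG].
    + unfold g. rewrite clip_id by lra. unfold minus, plus, opp; simpl. ring.
  - rewrite Rmin_left, Rmax_right by lra. intros x Hx.
    apply continuity_pt_minus; [apply HP, Hx|].
    apply continuity_pt_filterlim.
    apply (ex_derive_continuous (V := R_NormedModule)). eexists; apply HG.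
  - rewrite RInt_point in Hc. unfold zero in Hc; simpl in Hc. lra.
Qed.

(** A single height [e] at which only continuity is known does not spoil the
    fundamental theorem of calculus: split there. The height will be that of a
    removable singularity. *)
Lemma RInt_derive_except (P f : R -> R) e a b :
  a <= b ->
  (forall x, a <= x <= b -> continuity_pt P x) ->
  (forall x, a <= x <= b -> continuous f x) ->
  (forall x, a < x < b -> x <> e -> is_derive P x (f x)) ->
  RInt f a b = P b - P a.
Proof.
  intros Hab HP Hf HD.
  destruct (Rlt_dec a e) as [Hae|Hae]; [destruct (Rlt_dec e b) as [Heb|Heb]|].
  - rewrite <- (RInt_Chasles (V := R_CompleteNormedModule) f a e b);
      try (apply (ex_RInt_continuous (V := R_CompleteNormedModule));
           rewrite Rmin_left, Rmax_right by lra; intros; apply Hf; lra).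
    rewrite (RInt_derive_open P f a e), (RInt_derive_open P f e b);
      try lra; try (intros; apply HP; lra); try (intros; apply Hf; lra);
      try (intros; apply HD; lra).
    unfold plus; simpl. ring.
  - apply RInt_derive_open; auto. intros; apply HD; lra.
  - apply RInt_derive_open; auto. intros; apply HD; lra.
Qed.

(** Parametrizing the segment at height [eps * x] from abscissa [a x] to abscissa
    [r] by [s] in [0, 1] keeps all points inside the region swept out as [x]
    varies, so that differentiating under the integral needs no neighbourhood
    of the region of uniform width. *)
Definition seg (a : R -> R) (r eps x s : R) : C := (a x + s * (r - a x), eps * x).

Lemma Ccont_pair {T : UniformSpace} (f g : T -> R) x :
  continuous f x -> continuous g x -> Ccont (fun y => (f y, g y) : C) x.
Proof. split; assumption. Qed.

Lemma seg_cont a r eps x s :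
  continuous a x ->
  Ccont (fun q : R * R => seg a r eps (fst q) (snd q)) (x, s).
Proof.
  intro Ha.
  assert (Ha' : continuous (fun q : R * R => a (fst q)) (x, s)).
  { apply (continuous_comp (fst : R * R -> R) a); [apply continuous_fst|exact Ha]. }
  unfold seg; split; simpl.
  - apply (continuous_plus (V := R_NormedModule)); [exact Ha'|].
    apply (continuous_mult (K := R_AbsRing)); [apply continuous_snd|].
    apply (continuous_minus (V := R_NormedModule)); [apply continuous_const|exact Ha'].
  - apply (continuous_mult (K := R_AbsRing)); [apply continuous_const|apply continuous_fst].
Qed.

Lemma flux_continuity_2d (H : C -> C) (a : R -> R) r eps c x s :
  continuous a x -> cont_at H (seg a r eps x s) ->
  continuity_2d_pt (fun y t => Re (c * (H (seg a r eps y t) * RtoC (r - a y)))%C) x s.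
Proof.
  intros Ha HH. apply continuity_2d_pt_filterlim.
  apply (Ccont_scal_re c (fun q : R * R =>
    H (seg a r eps (fst q) (snd q)) * RtoC (r - a (fst q)))%C (x, s)).
  apply Ccont_mult.
  - apply HH; [reflexivity|apply seg_cont, Ha].
  - split; simpl; [|apply continuous_const].
    apply (continuous_minus (V := R_NormedModule)); [apply continuous_const|].
    apply (continuous_comp (fst : R * R -> R) a); [apply continuous_fst|exact Ha].
Qed.

Lemma Cder_re_scal c (f : R -> C) x l : Cder f x l -> is_derive (fun y => Re (c * f y)%C) x (Re (c * l)%C).
Proof.
  intro Hf. destruct (Cder_mult (fun _ => c) f x 0 l (Cder_const c x) Hf) as [h _].
  eapply is_derive_eq; [exact h|]. simpl. unfold Re, Im. simpl. ring.
Qed.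

(** Cauchy's theorem in differential form. Writing w(x, s) for the point of the
    segment, d/dx (H(w) w_s) = d/ds (H(w) w_x), since both sides are
    H'(w) w_x w_s + H(w) w_xs. Integrating the right side over s leaves the
    values of H(w) w_x at the two ends of the segment. *)
Lemma flux_derive (H H' : C -> C) (a a' : R -> R) r eps c v :
  locally v (fun x => forall s, 0 <= s <= 1 -> cont_at H (seg a r eps x s)) ->
  locally v (fun x => forall s, 0 <= s <= 1 -> hol_at H H' (seg a r eps x s)) ->
  (forall s, 0 <= s <= 1 -> locally_2d (fun x t => hol_at H H' (seg a r eps x t)) v s) ->
  (forall s, 0 <= s <= 1 -> cont_at H' (seg a r eps v s)) ->
  locally v (fun x => is_derive a x (a' x)) -> continuous a' v ->
  is_derive (fun x => RInt (fun s => Re (c * (H (seg a r eps x s) * RtoC (r - a x)))%C) 0 1) v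
    (Re (c * (H (seg a r eps v 1) * (0, eps) - H (seg a r eps v 0) * (a' v, eps)))%C).
Proof.
  intros Hcont Hhol Hhol2 Hcont' Ha Ha'.
  set (D := fun x s => (H' (seg a r eps x s) * (a' x * (1 - s), eps)%R * RtoC (r - a x)
                        - H (seg a r eps x s) * RtoC (a' x))%C).
  assert (Dv : forall x s, is_derive a x (a' x) -> hol_at H H' (seg a r eps x s) ->
     Cder (fun y => H (seg a r eps y s) * RtoC (r - a y))%C x (D x s)).
  { intros x s hax hh. eapply Cder_eq.
    - apply Cder_mult.
      + apply (hh (fun y => seg a r eps y s) x (a' x * (1 - s), eps)%R); [reflexivity|].
        unfold seg; split; simpl.
        * assert (ex_derive a x) by (eexists; exact hax).
          auto_derive; [tauto|].
          rewrite (is_derive_unique (fun y : R => a y) _ _ hax). ring.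
        * auto_derive; trivial; ring.
      + instantiate (1 := RtoC (- a' x)). split; simpl.
        * assert (ex_derive a x) by (eexists; exact hax).
          auto_derive; [tauto|].
          rewrite (is_derive_unique (fun y : R => a y) _ _ hax). ring.
        * apply (is_derive_const (V := R_NormedModule)).
    - unfold D. rewrite RtoC_opp. ring. }
  assert (Ds : forall s, 0 <= s <= 1 ->
     Cder (fun t => H (seg a r eps v t) * (a' v * (1 - t), eps)%R)%C s (D v s)).
  { intros s hs. eapply Cder_eq.
    - apply Cder_mult.
      + apply ((locally_singleton _ _ Hhol s hs) (fun t => seg a r eps v t) s (RtoC (r - a v)));
          [reflexivity|].
        unfold seg; split; simpl; auto_derive; trivial; ring.
      + instantiate (1 := RtoC (- a' v)). split; simpl; auto_derive; trivial; ring.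
    - unfold D. rewrite RtoC_opp. ring. }
  assert (Hav := locally_singleton _ _ Ha).
  assert (Hac : continuous a v).
  { apply (ex_derive_continuous (V := R_NormedModule)). eexists; exact Hav. }
  assert (HDc : forall s, 0 <= s <= 1 -> continuity_2d_pt (fun x t => Re (c * D x t)%C) v s).
  { intros s hs. apply continuity_2d_pt_filterlim.
    apply (Ccont_scal_re c (fun q : R * R => D (fst q) (snd q)) (v, s)).
    assert (hseg := seg_cont a r eps v s Hac).
    assert (ha' : continuous (fun q : R * R => a' (fst q)) (v, s)).
    { apply (continuous_comp (fst : R * R -> R) a'); [apply continuous_fst|exact Ha']. }
    unfold D. apply Ccont_plus; [apply Ccont_mult; [apply Ccont_mult|]|apply Ccont_opp, Ccont_mult].
    - apply (Hcont' s hs); [reflexivity|exact hseg].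
    - apply Ccont_pair; [|apply continuous_const].
      apply (continuous_mult (K := R_AbsRing)); [exact ha'|].
      apply (continuous_minus (V := R_NormedModule)); [apply continuous_const|apply continuous_snd].
    - apply Ccont_pair; [|apply continuous_const].
      apply (continuous_minus (V := R_NormedModule)); [apply continuous_const|].
      apply (continuous_comp (fst : R * R -> R) a); [apply continuous_fst|exact Hac].
    - apply (locally_singleton _ _ Hcont s hs); [reflexivity|exact hseg].
    - apply Ccont_pair; [exact ha'|apply continuous_const]. }
  set (f := fun x s => Re (c * (H (seg a r eps x s) * RtoC (r - a x)))%C).
  assert (Hf : forall x s, is_derive a x (a' x) -> hol_at H H' (seg a r eps x s) ->
     is_derive (fun y => f y s) x (Re (c * D x s)%C)).
  { intros x s hax hh. apply Cder_re_scal. apply Dv; assumption. }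
  eapply is_derive_eq.
  - apply (is_derive_RInt_param f 0 1 v).
    + rewrite Rmin_left, Rmax_right by lra.
      generalize (filter_and _ _ Ha Hhol). apply filter_imp. intros x [h1 h2] s hs.
      eexists. apply Hf; [exact h1|apply h2, hs].
    + rewrite Rmin_left, Rmax_right by lra. intros s hs.
      apply (continuity_2d_pt_ext_loc (fun x t => Re (c * D x t)%C)); [|apply HDc, hs].
      destruct (Hhol2 s hs) as [d1 Hd1]. destruct Ha as [d2 Hd2].
      exists (mkposreal _ (Rmin_pos _ _ (cond_pos d1) (cond_pos d2))). simpl.
      intros x t hx ht. symmetry. apply is_derive_unique. apply Hf.
      * apply Hd2. eapply Rlt_le_trans; [exact hx|apply Rmin_r].
      * apply Hd1; (eapply Rlt_le_trans; [eassumption|apply Rmin_l]).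
    + generalize (filter_and _ _ Ha Hcont). apply filter_imp. intros x [h1 h2].
      apply (ex_RInt_continuous (V := R_CompleteNormedModule)).
      rewrite Rmin_left, Rmax_right by lra. intros s hs.
      apply continuity_2d_pt_snd_cont. apply flux_continuity_2d; [|apply h2, hs].
      apply (ex_derive_continuous (V := R_NormedModule)). eexists; exact h1.
  - rewrite (RInt_ext _ (fun s => Re (c * D v s)%C)).
    2: { rewrite Rmin_left, Rmax_right by lra. intros s hs.
         apply is_derive_unique. apply Hf; [exact Hav|].
         apply (locally_singleton _ _ Hhol). lra. }
    apply is_RInt_unique.
    set (E := fun t => Re (c * (H (seg a r eps v t) * (a' v * (1 - t), eps)%R))%C).
    replace (Re _) with (minus (E 1) (E 0)).
    + apply (is_RInt_derive (V := R_CompleteNormedModule) E).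
      * rewrite Rmin_left, Rmax_right by lra. intros s hs. apply Cder_re_scal, Ds, hs.
      * rewrite Rmin_left, Rmax_right by lra. intros s hs.
        apply (continuity_2d_pt_snd_cont (fun x t => Re (c * D x t)%C)), HDc, hs.
    + unfold E, minus, plus, opp; simpl.
      replace (a' v * (1 - 1)) with 0 by ring. replace (a' v * (1 - 0)) with (a' v) by ring.
      unfold Re, Im; simpl. ring.
Qed.

(** * The functions v cot v and w e^w *)

Definition sinc (v : R) : R := if Req_EM_T v 0 then 1 else sin v / v.
(** The function v cot v, made regular at v = 0 by dividing by [sinc]. *)
Definition vcot (v : R) : R := cos v / sinc v.

Lemma sinc_0 : sinc 0 = 1.
Proof. unfold sinc. destruct Req_EM_T; [reflexivity|lra]. Qed.

Lemma sinc_eq v : v <> 0 -> sinc v = sin v / v.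
Proof. intro H. unfold sinc. destruct Req_EM_T; [contradiction|reflexivity]. Qed.

Lemma sin_sinc v : sin v = v * sinc v.
Proof.
  destruct (Req_dec v 0) as [->|H]; [rewrite sin_0; ring|].
  rewrite sinc_eq by exact H. field. exact H.
Qed.

Lemma sinc_even v : sinc (- v) = sinc v.
Proof.
  destruct (Req_dec v 0) as [->|H]; [f_equal; ring|].
  rewrite !sinc_eq by lra. rewrite sin_neg. field. exact H.
Qed.

Lemma vcot_even v : vcot (- v) = vcot v.
Proof. unfold vcot. rewrite sinc_even, cos_neg. reflexivity. Qed.

Lemma sinc_pos v : - PI < v < PI -> 0 < sinc v.
Proof.
  intro Hv. destruct (Req_dec v 0) as [->|H]; [rewrite sinc_0; lra|].
  assert (Hp : forall x, 0 < x < PI -> 0 < sinc x).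
  { intros x Hx. rewrite sinc_eq by lra. apply Rdiv_lt_0_compat; [apply sin_gt_0|]; lra. }
  destruct (Rlt_dec 0 v); [apply Hp; lra|].
  rewrite <- sinc_even. apply Hp; lra.
Qed.

Lemma sinc_PI : sinc PI = 0.
Proof. rewrite sinc_eq by apply PI_neq0. rewrite sin_PI. unfold Rdiv; ring. Qed.

Lemma sinc_continuous v : continuous sinc v.
Proof.
  destruct (Req_dec v 0) as [->|H].
  - apply continuity_pt_filterlim. intros eps Heps.
    destruct (derivable_pt_lim_sin 0 eps Heps) as [d Hd].
    exists d. split; [apply cond_pos|]. intros y [[_ Hn] Hy]. simpl in *. unfold R_dist in *.
    specialize (Hd y). rewrite sinc_0, sinc_eq by auto.
    rewrite sin_0, cos_0, Rplus_0_l, !Rminus_0_r in Hd. rewrite Rminus_0_r in Hy. apply Hd; auto.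
  - apply (continuous_ext_loc _ (fun x => sin x / x)).
    + assert (Hp : 0 < Rabs v) by (apply Rabs_pos_lt; exact H).
      exists (mkposreal _ Hp). intros y Hy. symmetry. apply sinc_eq.
      intros ->. unfold ball in Hy; simpl in Hy; unfold AbsRing_ball, abs, minus, plus, opp in Hy; simpl in Hy.
      rewrite Rplus_0_l, Rabs_Ropp in Hy. lra.
    + apply (ex_derive_continuous (V := R_NormedModule)). auto_derive. exact H.
Qed.

Lemma vcot_continuous v : - PI < v < PI -> continuous vcot v.
Proof.
  intro Hv. unfold vcot. apply (continuous_mult (K := R_AbsRing)).
  - apply (ex_derive_continuous (V := R_NormedModule)). auto_derive; trivial.
  - apply (continuous_real_comp Rinv sinc); [apply sinc_continuous|].
    auto_derive. apply Rgt_not_eq, sinc_pos, Hv.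
Qed.

Lemma vcot_eq v : 0 < v < PI -> vcot v = v * cot v.
Proof.
  intro Hv. unfold vcot, cot. rewrite sinc_eq by lra. assert (0 < sin v) by (apply sin_gt_0; lra).
  field. split; lra.
Qed.

Lemma vcot_0 : vcot 0 = 1.
Proof. unfold vcot. rewrite sinc_0, cos_0. field. Qed.

(** The derivative of - v cot v away from v = 0. *)
Definition dvcot (v : R) : R := v / sin v ^ 2 - cos v / sin v.

Lemma dvcot_derive v : 0 < v < PI -> is_derive (fun x => - vcot x) v (dvcot v).
Proof.
  intro Hv.
  assert (Hs : 0 < sin v) by (apply sin_gt_0; lra).
  apply (is_derive_ext_loc (fun x => - (x * cos x / sin x))).
  - assert (Hp : 0 < Rmin v (PI - v)) by (apply Rmin_pos; lra).
    exists (mkposreal _ Hp). intros y Hy.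
    unfold ball in Hy; simpl in Hy; unfold AbsRing_ball, abs, minus, plus, opp in Hy; simpl in Hy.
    assert (H1 := Rmin_l v (PI - v)). assert (H2 := Rmin_r v (PI - v)).
    apply Rabs_def2 in Hy.
    rewrite vcot_eq by lra. unfold cot. apply Ropp_eq_compat. unfold Rdiv; ring.
  - auto_derive; [lra|]. unfold dvcot.
    assert (Hc : cos v * cos v = 1 - sin v * sin v).
    { assert (h := sin2_cos2 v). unfold Rsqr in h. lra. }
    transitivity (- (sin v * cos v - v * (sin v * sin v + cos v * cos v)) / sin v ^ 2);
      [field; lra|].
    rewrite Hc. field. lra.
Qed.

Lemma dvcot_continuous v : 0 < v < PI -> continuous dvcot v.
Proof.
  intro Hv.
  assert (Hs : 0 < sin v) by (apply sin_gt_0; lra).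
  apply (ex_derive_continuous (V := R_NormedModule)). unfold dvcot. auto_derive.
  repeat split; try lra. apply Rgt_not_eq. nra.
Qed.

(** The derivative of - v cot v is (v - sin v cos v) / sin^2 v, and sin v < v. *)
Lemma vcot_decr x y : 0 <= x <= y -> y < PI -> - vcot x <= - vcot y.
Proof.
  intros Hx Hy. destruct (Req_dec x y) as [->|Hne]; [lra|].
  (* the mean value point may be an endpoint, and [dvcot 0 = 0] by convention *)
    assert (Hd : forall u, 0 <= u < PI -> 0 <= dvcot u).
    { intros u Hu. unfold dvcot. destruct (Req_dec u 0) as [->|Hu0].
      - rewrite sin_0. unfold Rdiv. rewrite Rinv_0. lra.
      - assert (Hs : 0 < sin u) by (apply sin_gt_0; lra).
        assert (Hs' := sin_lt_x u ltac:(lra)).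
        replace (u / sin u ^ 2 - cos u / sin u) with ((u - sin u * cos u) / sin u ^ 2)
          by (field; lra).
        apply Rdiv_le_0_compat; [|apply pow_lt; exact Hs].
        assert (h := COS_bound u). nra. }
    destruct (MVT_gen (fun u => - vcot u) x y dvcot) as [c [Hcr Hc]].
    + rewrite Rmin_left, Rmax_right by lra. intros u Hu. apply dvcot_derive; lra.
    + rewrite Rmin_left, Rmax_right by lra. intros u Hu.
      apply continuity_pt_opp, continuity_pt_filterlim, vcot_continuous; lra.
    + rewrite Rmin_left, Rmax_right in Hcr by lra.
      assert (0 <= dvcot c) by (apply Hd; lra). nra.
Qed.

Definition zeta (w : C) : C := (w * Cexp w)%C.

Lemma zeta_eq w : zeta w = (w * Cexp w)%C.
Proof. reflexivity. Qed.

Lemma Cexp_plus z w : Cexp (z + w)%C = (Cexp z * Cexp w)%C.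
Proof.
  unfold Cexp, Cmult; simpl. unfold Re, Im; simpl. rewrite exp_plus, cos_plus, sin_plus.
  f_equal; ring.
Qed.

Lemma Cexp_0 : Cexp 0 = 1.
Proof. unfold Cexp; simpl. rewrite exp_0, cos_0, sin_0. unfold RtoC. f_equal; ring. Qed.

Lemma Cexp_neq_0 z : Cexp z <> 0.
Proof.
  intro H. assert (h : (Cexp z * Cexp (- z))%C = 1).
  { rewrite <- Cexp_plus. replace (z + - z)%C with (RtoC 0) by ring. apply Cexp_0. }
  rewrite H, Cmult_0_l in h. injection h. lra.
Qed.

Lemma Cexp_opp z : Cexp (- z)%C = (/ Cexp z)%C.
Proof.
  assert (h : (Cexp z * Cexp (- z))%C = 1).
  { rewrite <- Cexp_plus. replace (z + - z)%C with (RtoC 0) by ring. apply Cexp_0. }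
  apply (f_equal (fun u => (/ Cexp z * u)%C)) in h.
  rewrite Cmult_assoc, Cinv_l, Cmult_1_l, Cmult_1_r in h by apply Cexp_neq_0. exact h.
Qed.

Lemma Cexp_conj z : Cexp (Cconj z) = Cconj (Cexp z).
Proof. unfold Cexp, Cconj; simpl. unfold Re, Im; simpl. rewrite cos_neg, sin_neg. f_equal; ring. Qed.

Lemma zeta_conj w : zeta (Cconj w) = Cconj (zeta w).
Proof. unfold zeta. rewrite Cexp_conj, Cmult_conj. reflexivity. Qed.

Lemma zeta_re x y : Re (zeta (x, y)) = exp x * (x * cos y - y * sin y).
Proof. unfold zeta, Cexp; simpl. ring. Qed.

Lemma zeta_im x y : Im (zeta (x, y)) = exp x * (x * sin y + y * cos y).
Proof. unfold zeta, Cexp; simpl. ring. Qed.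

(** With d = w2 - w1 = a + i b the equation reads w1 = (w1 + d) e^d, whence
    Im w1 |e^d - 1|^2 = e^a (b cos b + a sin b - b e^a). Exchanging w1 and w2 if
    necessary, 0 <= b < PI; then b e^a >= sin b (1 + a) >= b cos b + a sin b, so
    the right side is at most 0 while Im w1 > 0. Hence e^d = 1 and d = 0. *)
Lemma zeta_inj_strip w1 w2 :
  0 < Im w1 < PI -> 0 < Im w2 < PI -> zeta w1 = zeta w2 -> w1 = w2.
Proof.
  assert (main : forall x y a b, 0 < y -> 0 <= b < PI ->
     zeta (x, y) = zeta (x + a, y + b)%R -> a = 0 /\ b = 0).
  { intros x y a b hy hb h.
    assert (e : (x, y) = ((x + a, y + b)%R * Cexp (a, b)%R)%C).
    { apply (f_equal (fun u => (u * Cexp (- (x, y)))%C)) in h. unfold zeta in h.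
      rewrite <- !Cmult_assoc, <- !Cexp_plus in h.
      replace ((x, y) + - (x, y))%C with (RtoC 0) in h by ring.
      replace ((x + a, y + b)%R + - (x, y))%C with ((a, b) : C) in h
        by (unfold Cplus, Copp; simpl; f_equal; ring).
      rewrite Cexp_0, Cmult_1_r in h. exact h. }
    unfold Cexp, Cmult in e; simpl in e. injection e as e1 e2.
    set (A := exp a * cos b) in *. set (B := exp a * sin b) in *.
    assert (hs : y * ((A - 1) ^ 2 + B ^ 2) = - (A ^ 2 + B ^ 2) * b + A * b + B * a).
    { assert (f1 : (A - 1) * x - B * y = - (A * a - B * b)) by lra.
      assert (f2 : B * x + (A - 1) * y = - (A * b + B * a)) by lra.
      transitivity ((A - 1) * (B * x + (A - 1) * y) - B * ((A - 1) * x - B * y)); [ring|].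
      rewrite f1, f2. ring. }
    assert (hAB : A ^ 2 + B ^ 2 = exp a * exp a).
    { unfold A, B. assert (t := sin2_cos2 b). unfold Rsqr in t.
      transitivity (exp a * exp a * (sin b * sin b + cos b * cos b)); [ring|].
      rewrite t; ring. }
    rewrite hAB in hs.
    assert (hsb : 0 <= sin b) by (apply sin_ge_0; lra).
    assert (hsb' : sin b <= b).
    { destruct (Req_dec b 0) as [->|]; [rewrite sin_0; lra|]. left. apply sin_lt_x. lra. }
    assert (hsc : b * cos b <= sin b).
    { destruct (Req_dec b 0) as [->|]; [rewrite sin_0; lra|].
      destruct (Rlt_dec (cos b) 0); [nra|].
      assert (hk := vcot_decr 0 b ltac:(lra) ltac:(lra)). rewrite vcot_0 in hk.
      unfold vcot in hk. rewrite sinc_eq in hk by assumption.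
      assert (0 < sin b) by (apply sin_gt_0; lra).
      replace (cos b / (sin b / b)) with (b * cos b / sin b) in hk by (field; lra).
      assert (hq : b * cos b / sin b <= 1) by lra.
      apply (Rmult_le_compat_r (sin b)) in hq; [|lra]. unfold Rdiv in hq.
      rewrite Rmult_assoc, Rinv_l in hq by lra. lra. }
    assert (he := exp_ineq1_le a). assert (hp := exp_pos a).
    assert (hle : - (exp a * exp a) * b + A * b + B * a <= 0).
    { unfold A, B.
      replace (_ + _) with (exp a * (b * cos b + a * sin b - b * exp a)) by ring.
      assert (b * cos b + a * sin b - b * exp a <= 0).
      { assert (sin b * (1 + a) <= sin b * exp a) by (apply Rmult_le_compat_l; lra).
        assert (sin b * exp a <= b * exp a) by (apply Rmult_le_compat_r; lra). lra. }
      nra. }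
    assert (hz : (A - 1) ^ 2 + B ^ 2 = 0).
    { assert (h0 : 0 <= (A - 1) ^ 2 + B ^ 2)
        by (apply Rplus_le_le_0_compat; apply pow2_ge_0).
      destruct h0 as [h0|h0]; [|auto].
      assert (h0' := Rmult_lt_0_compat _ _ hy h0). lra. }
    assert (hA0 := pow2_ge_0 (A - 1)). assert (hB0 := pow2_ge_0 B).
    assert (hB : B = 0) by (apply Rsqr_0_uniq; unfold Rsqr; lra).
    assert (hA : A = 1).
    { apply Rminus_diag_uniq, Rsqr_0_uniq; unfold Rsqr; lra. }
    assert (hb0 : b = 0).
    { destruct (Req_dec b 0); [assumption|].
      assert (0 < sin b) by (apply sin_gt_0; lra). unfold B in hB. nra. }
    split; [|exact hb0]. unfold A in hA. rewrite hb0, cos_0, Rmult_1_r in hA.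
    rewrite <- exp_0 in hA. apply exp_inv in hA. exact hA. }
  destruct w1 as [x1 y1]; destruct w2 as [x2 y2]; simpl; intros h1 h2 h.
  destruct (Rle_dec y1 y2).
  - assert (e : zeta (x1, y1) = zeta (x1 + (x2 - x1), y1 + (y2 - y1))%R).
    { rewrite h. apply f_equal, f_equal2; ring. }
    apply main in e; [|lra|lra]. apply f_equal2; lra.
  - assert (e : zeta (x2, y2) = zeta (x2 + (x1 - x2), y2 + (y1 - y2))%R).
    { rewrite <- h. apply f_equal, f_equal2; ring. }
    apply main in e; [|lra|lra]. apply f_equal2; lra.
Qed.

Global Opaque zeta.

(** * The range of the principal branch *)

(** The region on and to the right of the curve u = - v cot v in the strip
    |v| < PI: the range of the principal branch together with the boundary
    curve, which zeta folds onto the cut. *)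
Definition lambert_domain (w : C) : Prop := - PI < Im w < PI /\ - vcot (Im w) <= Re w.

(** The function [t], made regular at v = 0. *)
Definition boundary_t (v : R) : R := - exp (- vcot v) / sinc v.

Lemma zeta_im_vcot x y : - PI < y < PI ->
  Im (zeta (x, y)) = exp x * sinc y * y * (x + vcot y).
Proof.
  intro Hy. assert (H := sinc_pos y Hy). rewrite zeta_im, sin_sinc. unfold vcot. field. lra.
Qed.

Lemma zeta_boundary y : - PI < y < PI -> zeta (- vcot y, y) = RtoC (boundary_t y).
Proof.
  intro Hy. assert (H := sinc_pos y Hy).
  assert (Im (zeta (- vcot y, y)) = 0) by (rewrite zeta_im_vcot by exact Hy; ring).
  assert (Re (zeta (- vcot y, y)) = boundary_t y).
  { rewrite zeta_re. unfold boundary_t.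
    assert (e : - vcot y * cos y - y * sin y = - 1 / sinc y).
    { apply (Rmult_eq_reg_r (sinc y)); [|lra].
      transitivity (- (cos y * cos y + sin y * (y * sinc y))); [unfold vcot; field; lra|].
      rewrite <- sin_sinc. assert (t := sin2_cos2 y). unfold Rsqr in t.
      transitivity (- (1)); [lra|field; lra]. }
    rewrite e. unfold Rdiv. ring. }
  apply injective_projections; assumption.
Qed.

Lemma boundary_t_neg y : - PI < y < PI -> boundary_t y < 0.
Proof.
  intro Hy. assert (H := sinc_pos y Hy). unfold boundary_t.
  assert (0 < exp (- vcot y) / sinc y) by (apply Rdiv_lt_0_compat; [apply exp_pos|exact H]).
  unfold Rdiv in *. lra.
Qed.

(** Im (zeta (u + i v)) is v times a positive multiple of u + v cot v, and
    u + v cot v = 0 would put zeta(w) on the cut. *)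
Lemma lambert_domain_cases w : lambert_domain w -> cut_plane 0 (zeta w) ->
  (0 < Im w /\ 0 < Im (zeta w)) \/ (Im w = 0 /\ 0 < Re w /\ Im (zeta w) = 0) \/
  (Im w < 0 /\ Im (zeta w) < 0).
Proof.
  destruct w as [x y]; intros [Hy Hx] Hc; simpl in *.
  assert (Hs := sinc_pos y Hy).
  assert (Hi := zeta_im_vcot x y Hy).
  assert (Hk : 0 < exp x * sinc y) by (apply Rmult_lt_0_compat; [apply exp_pos|exact Hs]).
  assert (Hn : x + vcot y <> 0).
  { intro E. apply Hc. assert (x = - vcot y) as -> by lra.
    rewrite zeta_boundary by exact Hy. simpl. split; [reflexivity|].
    apply Rlt_le, boundary_t_neg, Hy. }
  assert (Hp : 0 < x + vcot y) by lra.
  assert (Hq := Rmult_lt_0_compat _ _ Hk Hp).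
  rewrite Hi. destruct (Rtotal_order y 0) as [h|[h|h]].
  - right; right. split; [exact h|]. nra.
  - right; left. subst y. split; [reflexivity|]. split; [|ring].
    apply Rnot_le_lt. intro h. apply Hc. split; [rewrite Hi; ring|].
    rewrite zeta_re, cos_0. assert (e := exp_pos x). nra.
  - left. split; [exact h|]. nra.
Qed.

Lemma Cconj_inj z w : Cconj z = Cconj w -> z = w.
Proof. intro H. rewrite <- (Cconj_conj z), H. apply Cconj_conj. Qed.

(** Equal images have the same sign of Im, so by [lambert_domain_cases] both
    points are in the upper strip, on the positive axis or in the lower strip;
    conjugation reduces the last case to the first. *)
Lemma zeta_inj_lambert_domain p w :
  lambert_domain p -> lambert_domain w -> cut_plane 0 (zeta p) -> zeta w = zeta p -> w = p.
Proof.
  intros Hp Hw Hc E.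
  assert (Cp := lambert_domain_cases p Hp Hc).
  assert (Cw := lambert_domain_cases w Hw ltac:(rewrite E; exact Hc)). rewrite E in Cw.
  destruct Hp as [Hp1 Hp2]; destruct Hw as [Hw1 Hw2].
  destruct Cp as [[a1 a2]|[[a1 [a2 a3]]|[a1 a2]]];
    destruct Cw as [[b1 b2]|[[b1 [b2 b3]]|[b1 b2]]]; try lra.
  - apply zeta_inj_strip; [lra|lra|exact E].
  - destruct p as [xp yp]; destruct w as [xw yw]; simpl in *. subst yp yw.
    apply (f_equal Re) in E. rewrite !zeta_re, cos_0, sin_0 in E.
    f_equal. destruct (Rtotal_order xw xp) as [h|[h|h]]; [|exact h|].
    + assert (g := exp_increasing _ _ h). assert (g1 := exp_pos xw). nra.
    + assert (g := exp_increasing _ _ h). assert (g1 := exp_pos xp). nra.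
  - apply Cconj_inj. apply zeta_inj_strip; [unfold Im in *; simpl; lra|unfold Im in *; simpl; lra|].
    rewrite !zeta_conj, E. reflexivity.
Qed.

(** Continuity, the equation and the value at 0 already determine the range of W,
    and they are visibly stable under z -> conj (W (conj z)). *)
Definition LambertW_like (W : C -> C) : Prop :=
  (forall z, cut_plane (-1 / exp 1) z -> cont_at W z) /\
  (forall z, cut_plane (-1 / exp 1) z -> zeta (W z) = z) /\ W 0 = 0.

Lemma cont_at_of_continuous (W : C -> C) z :
  continuous (T := C_UniformSpace) (U := C_UniformSpace) W z -> cont_at W z.
Proof.
  intros H T w x <- [h1 h2]. destruct (w x) as [u v] eqn:E.
  assert (E1 : Re (w x) = u) by (rewrite E; reflexivity).
  assert (E2 : Im (w x) = v) by (rewrite E; reflexivity).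
  split.
  - apply (continuous_ext (fun y => Re (W (Re (w y), Im (w y))))).
    { intro y. destruct (w y); reflexivity. }
    apply (continuous_comp_2 (fun y => Re (w y)) (fun y => Im (w y)) (fun a b => Re (W (a, b))));
      try assumption.
    rewrite E1, E2.
    apply (continuous_ext (fun q : R * R => Re (W q))); [intros [a b]; reflexivity|].
    apply (continuous_comp W (fst : R * R -> R)); [exact H|apply continuous_fst].
  - apply (continuous_ext (fun y => Im (W (Re (w y), Im (w y))))).
    { intro y. destruct (w y); reflexivity. }
    apply (continuous_comp_2 (fun y => Re (w y)) (fun y => Im (w y)) (fun a b => Im (W (a, b))));
      try assumption.
    rewrite E1, E2.
    apply (continuous_ext (fun q : R * R => Im (W q))); [intros [a b]; reflexivity|].
    apply (continuous_comp W (snd : R * R -> R)); [exact H|apply continuous_snd].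
Qed.

Lemma principal_like W : principal_LambertW W -> LambertW_like W.
Proof.
  intros [H1 [H2 H3]]. split; [|split; [exact H2|exact H3]].
  intros z Hz. apply cont_at_of_continuous.
  assert (Hc := ex_derive_continuous (K := C_AbsRing) (V := C_NormedModule) W z (H1 z Hz)).
  intros P HP. apply Hc in HP. apply locally_C. exact HP.
Qed.

Lemma cut_plane_conj a z : cut_plane a z -> cut_plane a (Cconj z).
Proof. unfold cut_plane. simpl. intros H [h1 h2]. apply H. unfold Re, Im in *; simpl in *; split; lra. Qed.

Lemma LambertW_like_conj W : LambertW_like W -> LambertW_like (fun z => Cconj (W (Cconj z))).
Proof.
  intros [H1 [H2 H3]]. split; [|split].
  - intros z Hz T w x E [h1 h2].
    assert (h : Ccont (fun y => W (Cconj (w y))) x).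
    { apply (H1 (Cconj z) (cut_plane_conj _ _ Hz)); [rewrite E; reflexivity|].
      split; [exact h1|]. apply (continuous_opp (V := R_NormedModule)). exact h2. }
    destruct h as [g1 g2]. split; [exact g1|].
    apply (continuous_opp (V := R_NormedModule)). exact g2.
  - intros z Hz. rewrite zeta_conj, H2 by (apply cut_plane_conj, Hz). apply Cconj_conj.
  - replace (Cconj 0) with (RtoC 0) by (unfold Cconj, RtoC; simpl; f_equal; ring).
    rewrite H3. unfold Cconj, RtoC; simpl. f_equal; ring.
Qed.

Lemma no_crossing (f : R -> R) a b y :
  a <= b -> (forall x, a <= x <= b -> continuous f x) ->
  (forall x, a <= x <= b -> f x <> y) -> f a < y -> f b < y.
Proof.
  intros Hab Hc Hn Ha. apply Rnot_le_lt. intro Hb.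
  destruct (IVT_gen (fun x => f (clip a b x)) a b y) as [x [Hx E]].
  - intro x. apply continuity_pt_filterlim.
    apply (continuous_comp (clip a b) f); [apply clip_continuous|].
    apply Hc, clip_range, Hab.
  - rewrite !clip_id by lra. rewrite Rmin_left, Rmax_right; lra.
  - rewrite Rmin_left, Rmax_right in Hx by lra.
    rewrite clip_id in E by exact Hx. exact (Hn x Hx E).
Qed.

Lemma cut_plane_ray z s : cut_plane 0 z -> 0 <= s -> cut_plane (-1 / exp 1) (RtoC s * z)%C.
Proof.
  intros Hz Hs [h1 h2]. simpl in *.
  assert (He : -1 / exp 1 < 0).
  { assert (g := exp_pos 1). assert (0 < / exp 1) by (apply Rinv_0_lt_compat; exact g).
    unfold Rdiv. lra. }
  apply Hz. assert (E : s * Im z = 0) by (unfold Im; lra).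
  destruct (Rmult_integral _ _ E) as [->|E2]; [lra|]. split; [exact E2|].
  unfold Re, Im in *. nra.
Qed.

Lemma ray_cont W z s : LambertW_like W -> cut_plane 0 z -> 0 <= s ->
  Ccont (fun r : R => W (RtoC r * z)%C) s.
Proof.
  intros [H1 _] Hz Hs. apply (H1 _ (cut_plane_ray z s Hz Hs)); [reflexivity|].
  apply Ccont_mult; [|apply Ccont_const].
  split; simpl; [apply continuous_id|apply continuous_const].
Qed.

(** For small w the imaginary part of zeta(w) = w + O(w^2) has the sign of Im w. *)
Lemma upper_start u v : Rabs u < 1 / 2 -> Rabs v < 1 / 2 ->
  0 < u * sin v + v * cos v -> 0 < v.
Proof.
  intros Hu Hv H. apply Rabs_def2 in Hu. apply Rabs_def2 in Hv.
  apply Rnot_le_lt. intro Hle. destruct Hle as [Hlt| ->].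
  2: { rewrite sin_0 in H. lra. }
  assert (Hpi := PI2_3_2).
  set (s := - v). assert (E : v = - s) by (unfold s; ring).
  rewrite E, sin_neg, cos_neg in H. assert (Hs : 0 < s < 1 / 2) by (unfold s; lra).
  assert (H1 := sin_lt_x s ltac:(lra)). assert (H2 : 0 < sin s) by (apply sin_gt_0; lra).
  assert (H3 : 1 / 2 < cos s).
  { rewrite <- cos_PI3. apply cos_decreasing_1; lra. }
  nra.
Qed.

(** Along the segment from 0 to z, Im W never equals 0, since zeta would be real,
    nor PI, since Im (zeta (u + i PI)) = - PI e^u; and it is positive near 0. *)
Lemma LambertW_upper W z : LambertW_like W -> 0 < Im z -> 0 < Im (W z) < PI.
Proof.
  intros HW Hz.
  assert (Hcut : cut_plane 0 z) by (intros [h _]; lra).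
  assert (Hc := fun s Hs => ray_cont W z s HW Hcut Hs).
  assert (Heq : forall s, 0 < s -> 0 < Im (zeta (W (RtoC s * z)%C))).
  { intros s Hs. destruct HW as [_ [H2 _]]. rewrite H2 by (apply cut_plane_ray; [exact Hcut|lra]).
    simpl. unfold Im in *. nra. }
  assert (Hn0 : forall s, 0 < s -> Im (W (RtoC s * z)%C) <> 0).
  { intros s Hs E. specialize (Heq s Hs). destruct (W (RtoC s * z)%C) as [x y]; simpl in E; subst y.
    rewrite zeta_im, sin_0 in Heq. lra. }
  assert (Hnp : forall s, 0 < s -> Im (W (RtoC s * z)%C) <> PI).
  { intros s Hs E. specialize (Heq s Hs). destruct (W (RtoC s * z)%C) as [x y]; simpl in E; subst y.
    rewrite zeta_im, sin_PI, cos_PI in Heq. assert (g := exp_pos x). assert (g' := PI_RGT_0). nra. }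
  assert (Hst : exists s, 0 < s < 1 /\ 0 < Im (W (RtoC s * z)%C) < PI).
  { destruct (Hc 0 (Rle_refl 0)) as [c1 c2].
    assert (W0 : W (RtoC 0 * z)%C = 0) by (rewrite Cmult_0_l; apply HW).
    apply continuity_pt_filterlim in c1. apply continuity_pt_filterlim in c2.
    destruct (c1 (1/2) ltac:(lra)) as [d1 [D1 D1']].
    destruct (c2 (1/2) ltac:(lra)) as [d2 [D2 D2']].
    set (s := Rmin (Rmin d1 d2) 1 / 2).
    assert (g1 := Rmin_l d1 d2). assert (g2 := Rmin_r d1 d2).
    assert (g3 := Rmin_l (Rmin d1 d2) 1). assert (g4 := Rmin_r (Rmin d1 d2) 1).
    assert (g5 : 0 < Rmin (Rmin d1 d2) 1) by (repeat apply Rmin_pos; lra).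
    assert (Hs : 0 < s < 1) by (unfold s; lra).
    assert (ds : R_dist s 0 = s) by (unfold R_dist; rewrite Rminus_0_r; apply Rabs_pos_eq; lra).
    assert (n0 : D_x no_cond 0 s) by (split; [exact I|lra]).
    exists s. split; [exact Hs|].
    specialize (D1' s). specialize (D2' s). simpl in D1', D2'.
    rewrite ds, W0 in D1', D2'. unfold R_dist in D1', D2'. simpl in D1', D2'.
    rewrite Rminus_0_r in D1', D2'.
    assert (q1 : s < d1) by (unfold s; lra). assert (q2 : s < d2) by (unfold s; lra).
    assert (b1 := D1' (conj n0 q1)). assert (b2 := D2' (conj n0 q2)).
    specialize (Heq s ltac:(lra)).
    destruct (W (RtoC s * z)%C) as [x y]; simpl in *.
    rewrite zeta_im in Heq. assert (g := exp_pos x). assert (g' := PI2_3_2).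
    assert (0 < x * sin y + y * cos y).
    { apply (Rmult_lt_reg_l (exp x)); [exact g|]. rewrite Rmult_0_r. exact Heq. }
    split; [apply (upper_start x y); assumption|]. apply Rabs_def2 in b2. lra. }
  destruct Hst as [s [Hs [Hs1 Hs2]]].
  replace z with (RtoC 1 * z)%C by apply Cmult_1_l. split.
  - apply Ropp_lt_cancel. rewrite Ropp_0.
    apply (no_crossing (fun r => - Im (W (RtoC r * z)%C)) s 1 0); [lra| | |lra].
    + intros x Hx. apply (continuous_opp (V := R_NormedModule)). apply Hc; lra.
    + intros x Hx E. apply (Hn0 x); lra.
  - apply (no_crossing (fun r => Im (W (RtoC r * z)%C)) s 1 PI); [lra| | |lra].
    + intros x Hx. apply Hc; lra.
    + intros x Hx. apply Hnp; lra.
Qed.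

(** Along the segment from 0 to z, Im W never reaches PI or - PI. Inside the
    strip, zeta(w) is real only on the real axis and on the boundary curve, and
    on the latter it is negative. *)
Lemma LambertW_real W z : LambertW_like W -> Im z = 0 -> 0 < Re z -> Im (W z) = 0 /\ 0 <= Re (W z).
Proof.
  intros HW Hi Hr.
  assert (Hcut : cut_plane 0 z) by (intros [_ h]; lra).
  assert (Hc := fun s Hs => ray_cont W z s HW Hcut Hs).
  assert (H2 : zeta (W z) = z).
  { destruct HW as [_ [H2 _]]. apply H2. rewrite <- (Cmult_1_l z). apply cut_plane_ray; [exact Hcut|lra]. }
  assert (Heq : forall s, 0 <= s -> Im (zeta (W (RtoC s * z)%C)) = 0).
  { intros s Hs. destruct HW as [_ [H2' _]]. rewrite H2' by (apply cut_plane_ray; [exact Hcut|lra]).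
    simpl. unfold Im in *. rewrite Hi. ring. }
  assert (W0 : Im (W (RtoC 0 * z)%C) = 0).
  { rewrite Cmult_0_l. destruct HW as [_ [_ ->]]. reflexivity. }
  assert (Hpi := PI_RGT_0).
  assert (Hb : Im (W z) < PI /\ - PI < Im (W z)).
  { rewrite <- (Cmult_1_l z). split.
    - apply (no_crossing (fun r => Im (W (RtoC r * z)%C)) 0 1 PI); [lra| | |lra].
      + intros x Hx. apply Hc; lra.
      + intros x Hx E. specialize (Heq x ltac:(lra)).
        destruct (W (RtoC x * z)%C) as [x0 y]; simpl in E; subst y.
        rewrite zeta_im, sin_PI, cos_PI in Heq. assert (g := exp_pos x0). nra.
    - apply Ropp_lt_cancel. rewrite Ropp_involutive.
      apply (no_crossing (fun r => - Im (W (RtoC r * z)%C)) 0 1 PI); [lra| | |lra].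
      + intros x Hx. apply (continuous_opp (V := R_NormedModule)). apply Hc; lra.
      + intros x Hx E. specialize (Heq x ltac:(lra)).
        destruct (W (RtoC x * z)%C) as [x0 y]; simpl in E. assert (y = - PI) as -> by lra.
        rewrite zeta_im, sin_neg, cos_neg, sin_PI, cos_PI in Heq. assert (g := exp_pos x0). nra. }
  destruct (W z) as [x y]; simpl in *.
  assert (Hy : - PI < y < PI) by lra.
  assert (Hi' : Im (zeta (x, y)) = 0) by (rewrite H2; exact Hi).
  assert (Hr' : 0 < Re (zeta (x, y))) by (rewrite H2; exact Hr).
  rewrite (zeta_im_vcot x y Hy) in Hi'.
  assert (Hs := sinc_pos y Hy). assert (He := exp_pos x).
  apply Rmult_integral in Hi'. destruct Hi' as [Hi'|Hi'].
  - apply Rmult_integral in Hi'. destruct Hi' as [Hi'|Hi'].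
    + exfalso. assert (0 < exp x * sinc y) by (apply Rmult_lt_0_compat; lra). lra.
    + split; [exact Hi'|]. subst y. rewrite zeta_re, sin_0, cos_0 in Hr'.
      apply Rnot_lt_le. intro h. nra.
  - exfalso. assert (x = - vcot y) as -> by lra. rewrite zeta_boundary in Hr' by exact Hy.
    simpl in Hr'. assert (g := boundary_t_neg y Hy). lra.
Qed.

Lemma LambertW_lambert_domain_upper W z : LambertW_like W -> 0 < Im z -> zeta (W z) = z -> lambert_domain (W z).
Proof.
  intros HW Hz E. assert (H := LambertW_upper W z HW Hz). assert (Hpi := PI_RGT_0).
  rewrite <- E in Hz. destruct (W z) as [x y]; simpl in *. split; simpl; [lra|].
  rewrite zeta_im_vcot in Hz by lra. assert (Hs := sinc_pos y ltac:(lra)).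
  assert (Hk : 0 < exp x * sinc y * y).
  { repeat apply Rmult_lt_0_compat; try lra. apply exp_pos. }
  apply Rnot_lt_le. intro h. nra.
Qed.

Lemma LambertW_lambert_domain W z : LambertW_like W -> cut_plane 0 z -> zeta (W z) = z /\ lambert_domain (W z).
Proof.
  intros HW Hz.
  assert (E : forall W z, LambertW_like W -> cut_plane 0 z -> zeta (W z) = z).
  { intros W' z' [_ [H2 _]] h. apply H2. rewrite <- (Cmult_1_l z'). apply cut_plane_ray; [exact h|lra]. }
  split; [apply E; assumption|].
  assert (Hpi := PI_RGT_0).
  destruct (Rtotal_order (Im z) 0) as [h|[h|h]].
  - assert (HW' := LambertW_like_conj W HW).
    assert (D := LambertW_lambert_domain_upper _ (Cconj z) HW' ltac:(simpl; unfold Im in h; lra)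
                   (E _ _ HW' (cut_plane_conj _ _ Hz))).
    cbv beta in D. rewrite Cconj_conj in D. destruct D as [d1 d2].
    simpl in d1, d2. rewrite vcot_even in d2. split; unfold Re, Im in *; lra.
  - assert (Hr : 0 < Re z) by (apply Rnot_le_lt; intro; apply Hz; split; assumption).
    destruct (LambertW_real W z HW h Hr) as [a b].
    split; rewrite a; [lra|]. rewrite vcot_0. lra.
  - apply LambertW_lambert_domain_upper; auto.
Qed.

(** * Holomorphy along curves and the quotient (e^d - 1) / d *)

Lemma cont_at_const k w0 : cont_at (fun _ => k) w0.
Proof. intros T w x _ _. apply Ccont_const. Qed.

Lemma cont_at_id w0 : cont_at (fun w => w) w0.
Proof. intros T w x _ h. exact h. Qed.

Lemma cont_at_plus f g w0 : cont_at f w0 -> cont_at g w0 -> cont_at (fun w => f w + g w)%C w0.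
Proof. intros hf hg T w x e h. apply Ccont_plus; [apply hf|apply hg]; assumption. Qed.

Lemma cont_at_opp f w0 : cont_at f w0 -> cont_at (fun w => - f w)%C w0.
Proof. intros hf T w x e h. apply Ccont_opp, hf; assumption. Qed.

Lemma cont_at_mult f g w0 : cont_at f w0 -> cont_at g w0 -> cont_at (fun w => f w * g w)%C w0.
Proof. intros hf hg T w x e h. apply Ccont_mult; [apply hf|apply hg]; assumption. Qed.

Lemma cont_at_inv (f : C -> C) w0 : f w0 <> 0 -> cont_at f w0 -> cont_at (fun w => / f w)%C w0.
Proof. intros h0 hf T w x e h. apply Ccont_inv; [rewrite e; exact h0|apply hf; assumption]. Qed.

Lemma cont_at_comp f g w0 : cont_at g w0 -> cont_at f (g w0) -> cont_at (fun w => f (g w)) w0.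
Proof. intros hg hf T w x e h. apply hf; [rewrite e; reflexivity|apply hg; assumption]. Qed.

Lemma cont_at_exp w0 : cont_at Cexp w0.
Proof. intros T w x e h. apply Ccont_exp, h. Qed.

Lemma hol_at_const k w0 : hol_at (fun _ => k) (fun _ => RtoC 0) w0.
Proof. intros w x l _ _. eapply Cder_eq; [apply Cder_const|]. ring. Qed.

Lemma hol_at_id w0 : hol_at (fun w => w) (fun _ => RtoC 1) w0.
Proof. intros w x l _ h. eapply Cder_eq; [exact h|]. ring. Qed.

Lemma hol_at_plus f g f' g' w0 : hol_at f f' w0 -> hol_at g g' w0 ->
  hol_at (fun w => f w + g w)%C (fun w => f' w + g' w)%C w0.
Proof.
  intros hf hg w x l e h. eapply Cder_eq; [apply Cder_plus; [apply hf|apply hg]; eassumption|]. ring.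
Qed.

Lemma hol_at_mult f g f' g' w0 : hol_at f f' w0 -> hol_at g g' w0 ->
  hol_at (fun w => f w * g w)%C (fun w => f' w * g w + f w * g' w)%C w0.
Proof.
  intros hf hg w x l e h. eapply Cder_eq; [apply Cder_mult; [apply hf|apply hg]; eassumption|].
  rewrite <- e. ring.
Qed.

Lemma hol_at_inv (f f' : C -> C) w0 : f w0 <> 0 -> hol_at f f' w0 ->
  hol_at (fun w => / f w)%C (fun w => - f' w / (f w * f w))%C w0.
Proof.
  intros h0 hf w x l e h. eapply Cder_eq.
  - apply Cder_inv; [rewrite e; exact h0|apply hf; eassumption].
  - cbv beta. rewrite e. field. exact h0.
Qed.

Lemma hol_at_comp f g f' g' w0 : hol_at g g' w0 -> hol_at f f' (g w0) ->
  hol_at (fun w => f (g w)) (fun w => f' (g w) * g' w)%C w0.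
Proof.
  intros hg hf w x l e h. eapply Cder_eq.
  - apply (hf (fun y => g (w y))); [rewrite e; reflexivity|apply hg; eassumption].
  - ring.
Qed.

Lemma hol_at_exp w0 : hol_at Cexp Cexp w0.
Proof. intros w x l e h. eapply Cder_eq; [apply Cder_exp, h|]. rewrite e. ring. Qed.

Definition expm1_quot (d : C) : C := if Ceq_dec d 0 then 1 else ((Cexp d - 1) / d)%C.
Definition expm1_quot' (d : C) : C := ((Cexp d * d + - (Cexp d + - 1)) * / (d * d))%C.

Lemma expm1_quot_0 : expm1_quot 0 = 1.
Proof. unfold expm1_quot. destruct Ceq_dec; [reflexivity|contradiction]. Qed.

Lemma expm1_quot_neq (d : C) : d <> 0 -> expm1_quot d = ((Cexp d - 1) / d)%C.
Proof. intro H. unfold expm1_quot. destruct Ceq_dec; [contradiction|reflexivity]. Qed.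

Lemma expm1_quot_mult d : (expm1_quot d * d)%C = (Cexp d - 1)%C.
Proof.
  destruct (Ceq_dec d 0) as [->|H].
  - rewrite expm1_quot_0, Cexp_0. ring.
  - rewrite expm1_quot_neq by exact H. field. exact H.
Qed.

Lemma exp_taylor1 a : Rabs a <= 1 / 2 -> Rabs (exp a - 1) <= 2 * Rabs a /\ Rabs (exp a - 1 - a) <= 2 * a ^ 2.
Proof.
  intro Ha.
  assert (h1 := exp_ineq1_le a). assert (h2 := exp_ineq1_le (- a)).
  assert (h3 : exp a * exp (- a) = 1) by (rewrite <- exp_plus, Rplus_opp_r; apply exp_0).
  assert (h4 := exp_pos a).
  rewrite (Rabs_pos_eq (exp a - 1 - a)) by lra.
  assert (h6 : exp a * (1 - a) <= 1) by nra.
  unfold Rabs in *; destruct (Rcase_abs a); destruct Rcase_abs; split; nra.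
Qed.

Lemma sin_taylor b : Rabs (sin b) <= Rabs b /\ Rabs (cos b - 1) <= b ^ 2 / 2.
Proof.
  assert (H : forall u, Rabs (sin u) <= Rabs u).
  { intro u. destruct (MVT_gen sin 0 u cos) as [c [_ Hc]].
    - intros x _. apply is_derive_sin.
    - intros x _. apply continuity_sin.
    - rewrite sin_0, !Rminus_0_r in Hc. rewrite Hc, Rabs_mult.
      assert (g := COS_bound c). assert (Rabs (cos c) <= 1) by (apply Rabs_le; lra).
      assert (g' := Rabs_pos u). nra. }
  split; [apply H|].
  assert (E : cos b - 1 = - (2 * sin (b / 2) ^ 2)).
  { replace b with (2 * (b / 2)) at 1 by field. rewrite cos_2a_sin. ring. }
  rewrite E, Rabs_Ropp, Rabs_mult, <- RPow_abs, (Rabs_pos_eq 2) by lra.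
  assert (g := H (b / 2)). assert (g' := Rabs_pos (sin (b / 2))).
  assert (h : Rabs (sin (b / 2)) ^ 2 <= Rabs (b / 2) ^ 2) by (apply pow_incr; lra).
  rewrite (pow2_abs (b / 2)) in h. nra.
Qed.

Lemma sin_taylor3 b : Rabs b <= 1 -> Rabs (sin b - b) <= b ^ 2 / 2.
Proof.
  intro Hb.
  destruct (MVT_gen (fun x => sin x - x) 0 b (fun x => cos x - 1)) as [c [Hcr Hc]].
  - intros u _. eapply is_derive_eq.
    + apply (is_derive_minus (V := R_NormedModule) sin (fun x => x)); [apply is_derive_sin|apply is_derive_id].
    + unfold minus, plus, opp, one; simpl. ring.
  - intros u _. apply continuity_pt_filterlim.
    apply (ex_derive_continuous (V := R_NormedModule) (fun x => sin x - x)). auto_derive; trivial.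
  - rewrite sin_0, !Rminus_0_r in Hc. rewrite Hc, Rabs_mult.
    destruct (sin_taylor c) as [_ g].
    assert (hc : c ^ 2 <= b ^ 2).
    { rewrite <- (pow2_abs c), <- (pow2_abs b). apply pow_incr. split; [apply Rabs_pos|].
      unfold Rmin, Rmax in Hcr. unfold Rabs. destruct Rle_dec; repeat destruct Rcase_abs; lra. }
    assert (g' := Rabs_pos b). assert (g'' := Rabs_pos (cos c - 1)). nra.
Qed.

(** Second-order Taylor bounds for exp, cos and sin give
    |e^d - 1 - d| <= 6 |d|^2. *)
Lemma expm1_quot_bound (d : C) : Rabs (Re d) <= 1 / 2 -> Rabs (Im d) <= 1 / 2 ->
  Cmod (expm1_quot d - 1)%C <= 6 * Cmod d.
Proof.
  intros Ha Hb. destruct (Ceq_dec d 0) as [->|H0].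
  - rewrite expm1_quot_0, Cmod_0. replace (1 - 1)%C with (RtoC 0) by ring. rewrite Cmod_0. lra.
  - assert (Hd : 0 < Cmod d) by (apply Cmod_gt_0; exact H0).
    apply (Rmult_le_reg_r (Cmod d)); [exact Hd|].
    rewrite <- Cmod_mult.
    replace ((expm1_quot d - 1) * d)%C with (Cexp d - 1 - d)%C.
    2: { rewrite <- expm1_quot_mult. ring. }
    replace (6 * Cmod d * Cmod d) with (6 * Cmod d ^ 2) by ring. rewrite Cmod2_alt.
    destruct d as [a b]; simpl Re in *; simpl Im in *.
    assert (h := exp_taylor1 a Ha). destruct h as [h1 h2].
    destruct (sin_taylor b) as [h3 h4]. assert (h5 := sin_taylor3 b ltac:(lra)).
    assert (hX : Rabs (exp a * cos b - 1 - a) <= 2 * a ^ 2 + b ^ 2).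
    { replace (exp a * cos b - 1 - a) with ((exp a - 1 - a) + exp a * (cos b - 1)) by ring.
      eapply Rle_trans; [apply Rabs_triang|]. rewrite Rabs_mult.
      assert (exp a <= 2) by (apply Rabs_le_between in h1; lra).
      rewrite (Rabs_pos_eq (exp a)) by (left; apply exp_pos).
      assert (g := Rabs_pos (cos b - 1)). assert (g' := exp_pos a). nra. }
    assert (hY : Rabs (exp a * sin b - b) <= a ^ 2 + 2 * b ^ 2).
    { replace (exp a * sin b - b) with ((exp a - 1) * sin b + (sin b - b)) by ring.
      eapply Rle_trans; [apply Rabs_triang|]. rewrite Rabs_mult.
      assert (Rabs (exp a - 1) * Rabs (sin b) <= 2 * Rabs a * Rabs b)
        by (apply Rmult_le_compat; auto using Rabs_pos).
      rewrite <- (pow2_abs a), <- (pow2_abs b) in *.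
      assert (g := pow2_ge_0 (Rabs a - Rabs b)). nra. }
    eapply Rle_trans; [apply Cmod_2Rmax|].
    unfold Cexp; simpl.
    replace (exp a * cos b + - (1) + - a) with (exp a * cos b - 1 - a) by ring.
    replace (exp a * sin b + - 0 + - b) with (exp a * sin b - b) by ring.
    assert (hs : sqrt 2 <= 2).
    { rewrite <- (sqrt_square 2) at 2 by lra. apply sqrt_le_1_alt. lra. }
    assert (hm : Rmax (Rabs (exp a * cos b - 1 - a)) (Rabs (exp a * sin b - b)) <= 3 * (a ^ 2 + b ^ 2)).
    { apply Rmax_lub; assert (g := pow2_ge_0 a); assert (g' := pow2_ge_0 b); lra. }
    assert (hm0 : 0 <= Rmax (Rabs (exp a * cos b - 1 - a)) (Rabs (exp a * sin b - b))).
    { eapply Rle_trans; [apply Rabs_pos|apply Rmax_l]. }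
    assert (hs0 := sqrt_pos 2).
    eapply Rle_trans; [apply Rmult_le_compat; [exact hs0|exact hm0|exact hs|exact hm]|].
    simpl; lra.
Qed.

Lemma continuous_Rabs_lt {T : UniformSpace} (f : T -> R) x (eps : posreal) :
  continuous f x -> locally x (fun y => Rabs (f y - f x) < eps).
Proof. intro H. exact (H _ (locally_ball (T := R_UniformSpace) _ eps)). Qed.

Lemma cont_at_expm1_quot_0 : cont_at expm1_quot 0.
Proof.
  intros T w x E [h1 h2].
  assert (Hmain : forall eps : posreal, locally x (fun y => Cmod (expm1_quot (w y) - 1)%C < eps)).
  { intro eps.
    assert (hd : 0 < Rmin (1 / 2) (eps / 24)) by (apply Rmin_pos; [lra|assert (g := cond_pos eps); lra]).
    generalize (filter_and _ _ (continuous_Rabs_lt _ _ (mkposreal _ hd) h1)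
                  (continuous_Rabs_lt _ _ (mkposreal _ hd) h2)). apply filter_imp.
    intros y [b1 b2]. rewrite E in b1, b2. simpl in b1, b2. rewrite Rminus_0_r in b1, b2.
    assert (m1 := Rmin_l (1 / 2) (eps / 24)). assert (m2 := Rmin_r (1 / 2) (eps / 24)).
    eapply Rle_lt_trans; [apply expm1_quot_bound; unfold Re, Im in *; lra|].
    assert (g := Cmod_2Rmax (w y)).
    assert (gm : Rmax (Rabs (fst (w y))) (Rabs (snd (w y))) < eps / 24)
      by (apply Rmax_lub_lt; unfold Re, Im in *; lra).
    assert (hs : sqrt 2 <= 2).
    { rewrite <- (sqrt_square 2) at 2 by lra. apply sqrt_le_1_alt. lra. }
    assert (hs0 := sqrt_pos 2).
    assert (hm0 : 0 <= Rmax (Rabs (fst (w y))) (Rabs (snd (w y)))).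
    { eapply Rle_trans; [apply Rabs_pos|apply Rmax_l]. }
    assert (ge := cond_pos eps). nra. }
  split; intros P [eps HP]; unfold filtermap; generalize (Hmain eps); apply filter_imp; intros y hy;
    apply HP; rewrite E, expm1_quot_0; unfold ball; simpl;
    unfold AbsRing_ball, abs, minus, plus, opp; simpl;
    (eapply Rle_lt_trans; [|exact hy]).
  - apply (re_le_Cmod (expm1_quot (w y) - 1)%C).
  - eapply Rle_trans; [|apply (Rmax_Cmod (expm1_quot (w y) - 1)%C)]. apply Rmax_r.
Qed.

Lemma locally_neq0 {T : UniformSpace} (f : T -> C) x :
  Ccont f x -> f x <> 0 -> locally x (fun y => f y <> 0).
Proof.
  intros [h1 h2] h0. apply Cnorm2_neq_0 in h0.
  assert (hc : continuous (fun y => Re (f y) ^ 2 + Im (f y) ^ 2) x).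
  { apply (continuous_plus (V := R_NormedModule));
      (apply (continuous_real_comp (fun u => u ^ 2)); [assumption|auto_derive; trivial]). }
  assert (hp : 0 < Rabs (Re (f x) ^ 2 + Im (f x) ^ 2)) by (apply Rabs_pos_lt; exact h0).
  generalize (continuous_Rabs_lt _ _ (mkposreal _ hp) hc). apply filter_imp.
  intros y hy E. apply (Rlt_irrefl (Rabs (Re (f x) ^ 2 + Im (f x) ^ 2))).
  eapply Rle_lt_trans; [right|exact hy].
  rewrite <- Rabs_Ropp. f_equal. rewrite E. simpl. ring.
Qed.

Lemma cont_at_ext_neq0 (f g : C -> C) (w0 : C) :
  (forall w : C, w <> 0 -> f w = g w) -> w0 <> 0 -> cont_at f w0 -> cont_at g w0.
Proof.
  intros E h0 H T w x e hw. destruct (H T w x e hw) as [h1 h2].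
  assert (l : locally x (fun y => w y <> 0)) by (apply locally_neq0; [exact hw|rewrite e; exact h0]).
  split.
  - apply (continuous_ext_loc _ (fun y => Re (f (w y)))); [|exact h1].
    generalize l. apply filter_imp. intros y hy. rewrite (E _ hy). reflexivity.
  - apply (continuous_ext_loc _ (fun y => Im (f (w y)))); [|exact h2].
    generalize l. apply filter_imp. intros y hy. rewrite (E _ hy). reflexivity.
Qed.

Lemma Cder_continuous f x l : Cder f x l -> Ccont f x.
Proof.
  intros [h1 h2]. split; apply (ex_derive_continuous (V := R_NormedModule)); eexists; eassumption.
Qed.

Lemma hol_at_ext_neq0 (f g f' : C -> C) (w0 : C) :
  (forall w : C, w <> 0 -> f w = g w) -> w0 <> 0 -> hol_at f f' w0 -> hol_at g f' w0.
Proof.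
  intros E h0 H w x l e hw. destruct (H w x l e hw) as [h1 h2].
  assert (lo : locally x (fun y => w y <> 0)).
  { apply locally_neq0; [apply (Cder_continuous _ _ _ hw)|rewrite e; exact h0]. }
  split.
  - apply (is_derive_ext_loc (fun y => Re (f (w y)))); [|exact h1].
    generalize lo. apply filter_imp. intros y hy. rewrite (E _ hy). reflexivity.
  - apply (is_derive_ext_loc (fun y => Im (f (w y)))); [|exact h2].
    generalize lo. apply filter_imp. intros y hy. rewrite (E _ hy). reflexivity.
Qed.

Lemma cont_at_expm1_quot d : cont_at expm1_quot d.
Proof.
  destruct (Ceq_dec d 0) as [->|H]; [apply cont_at_expm1_quot_0|].
  apply (cont_at_ext_neq0 (fun w => (Cexp w + - (1)) * / w)%C); [|exact H|].
  - intros w hw. rewrite expm1_quot_neq by exact hw. reflexivity.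
  - apply cont_at_mult; [apply cont_at_plus; [apply cont_at_exp|apply cont_at_const]|].
    apply cont_at_inv; [exact H|apply cont_at_id].
Qed.

Lemma hol_at_eq f f' g' w0 : hol_at f f' w0 -> f' w0 = g' w0 -> hol_at f g' w0.
Proof. intros H E w x l e h. rewrite <- E. apply H; assumption. Qed.

Lemma hol_at_expm1_quot (d : C) : d <> 0 -> hol_at expm1_quot expm1_quot' d.
Proof.
  intro H. apply (hol_at_ext_neq0 (fun w => (Cexp w + - (1)) * / w)%C); [|exact H|].
  - intros w hw. rewrite expm1_quot_neq by exact hw. reflexivity.
  - eapply hol_at_eq.
    + apply hol_at_mult; [apply hol_at_plus; [apply hol_at_exp|apply hol_at_const]|].
      apply hol_at_inv; [exact H|apply hol_at_id].
    + unfold expm1_quot'. simpl. field. exact H.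
Qed.

Lemma cont_at_expm1_quot' (d : C) : d <> 0 -> cont_at expm1_quot' d.
Proof.
  intro H. unfold expm1_quot'. apply cont_at_mult.
  - apply cont_at_plus; [apply cont_at_mult; [apply cont_at_exp|apply cont_at_id]|].
    apply cont_at_opp, cont_at_plus; [apply cont_at_exp|apply cont_at_const].
  - apply cont_at_inv; [|apply cont_at_mult; apply cont_at_id].
    apply Cmult_neq_0; exact H.
Qed.

(** * The Cauchy integrand with its singularity removed *)

(** The quotient (zeta(w) - zeta(p)) / (w - p) without its singularity: expand
    zeta(w) around p using e^w = e^p e^(w-p). In the same way [exp_quot] is
    zeta'(w) (e^(s w) - e^(s p)) / (w - p). *)
Definition zeta_quot (p w : C) : C := (Cexp p * (p * expm1_quot (w + - p) + Cexp (w + - p)))%C.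

Definition exp_quot (s p w : C) : C :=
  ((1 + w) * Cexp w * (s * Cexp (s * p) * expm1_quot (s * (w + - p))))%C.

(** The Cauchy integrand zeta'(w) (e^(s w) - e^(s p)) / (zeta(w) - zeta(p)),
    continuous also at w = p. *)
Definition pole_quot (s p w : C) : C := (exp_quot s p w * / zeta_quot p w)%C.

Lemma zeta_quot_mult p w : (zeta_quot p w * (w - p))%C = (zeta w - zeta p)%C.
Proof.
  unfold zeta_quot. rewrite !zeta_eq.
  transitivity (Cexp p * (p * (expm1_quot (w + - p) * (w + - p)) + (w - p) * Cexp (w + - p)))%C; [ring|].
  rewrite expm1_quot_mult.
  replace (Cexp w) with (Cexp p * Cexp (w + - p))%C; [ring|].
  rewrite <- Cexp_plus. f_equal. ring.
Qed.

Lemma exp_quot_mult s p w :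
  (exp_quot s p w * (w - p))%C = ((1 + w) * Cexp w * (Cexp (s * w) - Cexp (s * p)))%C.
Proof.
  unfold exp_quot.
  transitivity ((1 + w) * Cexp w * (Cexp (s * p) * (expm1_quot (s * (w + - p)) * (s * (w + - p)))))%C; [ring|].
  rewrite expm1_quot_mult.
  replace (Cexp (s * w)) with (Cexp (s * p) * Cexp (s * (w + - p)))%C; [ring|].
  rewrite <- Cexp_plus. f_equal. ring.
Qed.

Lemma pole_quot_eq s p w : zeta w <> zeta p ->
  pole_quot s p w = ((1 + w) * Cexp w * (Cexp (s * w) - Cexp (s * p)) / (zeta w - zeta p))%C.
Proof.
  intro H.
  assert (Hz : (zeta w - zeta p)%C <> 0).
  { intro E. apply H. replace (zeta w) with (zeta p + (zeta w - zeta p))%C by ring. rewrite E. ring. }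
  rewrite <- exp_quot_mult. rewrite <- zeta_quot_mult in Hz |- *.
  unfold pole_quot. field. split.
  - intro E. apply Hz. rewrite E. ring.
  - intro E. apply Hz. replace (w - p)%C with (w + - p)%C by ring. 
    unfold Cminus in *. rewrite E. ring.
Qed.

Lemma zeta_m1 : zeta (RtoC (-1)) = RtoC (-1 / exp 1).
Proof.
  rewrite zeta_eq. unfold Cexp, Cmult, RtoC; simpl. rewrite cos_0, sin_0.
  replace (-1) with (- (1)) by ring. rewrite exp_Ropp. apply f_equal2; unfold Rdiv; ring.
Qed.

(** At w = p the value is e^p (p + 1), and p = -1 is excluded because
    zeta(-1) = -1/e is on the cut; elsewhere zeta is injective. *)
Lemma zeta_quot_neq0 p w : lambert_domain p -> lambert_domain w -> cut_plane 0 (zeta p) -> zeta_quot p w <> 0.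
Proof.
  intros Hp Hw Hc E. destruct (Ceq_dec w p) as [->|Hne].
  - unfold zeta_quot in E. replace (p + - p)%C with (RtoC 0) in E by ring.
    rewrite expm1_quot_0, Cexp_0 in E.
    assert (E' : (p + 1)%C = 0).
    { replace (p + 1)%C with (/ Cexp p * (Cexp p * (p * 1 + 1)))%C.
      - rewrite E. ring.
      - field. apply Cexp_neq_0. }
    assert (p = RtoC (-1)) as ->.
    { replace p with ((p + 1) - 1)%C by ring. rewrite E'. rewrite <- RtoC_minus. f_equal; ring. }
    apply Hc. rewrite zeta_m1. simpl. split; [reflexivity|].
    assert (g := exp_pos 1). assert (0 < / exp 1) by (apply Rinv_0_lt_compat; exact g).
    unfold Rdiv. lra.
  - apply Hne, (zeta_inj_lambert_domain p w Hp Hw Hc).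
    assert (h := zeta_quot_mult p w). rewrite E, Cmult_0_l in h.
    replace (zeta w) with (zeta p + (zeta w - zeta p))%C by ring. rewrite <- h. ring.
Qed.

Lemma cont_at_shift p w0 : cont_at (fun w => w + - p)%C w0.
Proof. apply cont_at_plus; [apply cont_at_id|apply cont_at_const]. Qed.

Lemma hol_at_shift p w0 : hol_at (fun w => w + - p)%C (fun _ => 1 + 0)%C w0.
Proof. apply hol_at_plus; [apply hol_at_id|apply hol_at_const]. Qed.

Lemma cont_at_zeta_quot p w0 : cont_at (zeta_quot p) w0.
Proof.
  unfold zeta_quot. apply cont_at_mult; [apply cont_at_const|].
  apply cont_at_plus; [apply cont_at_mult; [apply cont_at_const|]|].
  - apply (cont_at_comp expm1_quot); [apply cont_at_shift|apply cont_at_expm1_quot].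
  - apply (cont_at_comp Cexp); [apply cont_at_shift|apply cont_at_exp].
Qed.

Lemma cont_at_exp_quot s p w0 : cont_at (exp_quot s p) w0.
Proof.
  unfold exp_quot. apply cont_at_mult; [apply cont_at_mult|apply cont_at_mult].
  - apply cont_at_plus; [apply cont_at_const|apply cont_at_id].
  - apply cont_at_exp.
  - apply cont_at_const.
  - apply (cont_at_comp expm1_quot (fun w => s * (w + - p))%C); [|apply cont_at_expm1_quot].
    apply cont_at_mult; [apply cont_at_const|apply cont_at_shift].
Qed.

Lemma cont_at_pole_quot s p w0 : zeta_quot p w0 <> 0 -> cont_at (pole_quot s p) w0.
Proof.
  intro H. unfold pole_quot. apply cont_at_mult; [apply cont_at_exp_quot|].
  apply cont_at_inv; [exact H|apply cont_at_zeta_quot].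
Qed.

Definition zeta_quot' (p w : C) : C :=
  (Cexp p * (p * expm1_quot' (w + - p) + Cexp (w + - p)))%C.

Definition exp_quot' (s p w : C) : C :=
  ((Cexp w + (1 + w) * Cexp w) * (s * Cexp (s * p) * expm1_quot (s * (w + - p)))
   + (1 + w) * Cexp w * (s * Cexp (s * p) * (expm1_quot' (s * (w + - p)) * s)))%C.

Definition pole_quot' (s p w : C) : C :=
  (exp_quot' s p w * / zeta_quot p w + exp_quot s p w * (- zeta_quot' p w * / (zeta_quot p w * zeta_quot p w)))%C.

Lemma shift_neq0 p w : w <> p -> (w + - p)%C <> 0.
Proof. intros H E. apply H. replace w with (w + - p + p)%C by ring. rewrite E. ring. Qed.

Lemma hol_at_zeta_quot p w0 : w0 <> p -> hol_at (zeta_quot p) (zeta_quot' p) w0.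
Proof.
  intro H. apply shift_neq0 in H. unfold zeta_quot. eapply hol_at_eq.
  - apply hol_at_mult; [apply hol_at_const|].
    apply hol_at_plus; [apply hol_at_mult; [apply hol_at_const|]|].
    + apply (hol_at_comp expm1_quot (fun w => w + - p)%C); [apply hol_at_shift|apply hol_at_expm1_quot, H].
    + apply (hol_at_comp Cexp (fun w => w + - p)%C); [apply hol_at_shift|apply hol_at_exp].
  - unfold zeta_quot'. cbv beta. ring.
Qed.

Lemma hol_at_exp_quot (s p w0 : C) : s <> 0 -> w0 <> p -> hol_at (exp_quot s p) (exp_quot' s p) w0.
Proof.
  intros Hs H. apply shift_neq0 in H. unfold exp_quot. eapply hol_at_eq.
  - apply hol_at_mult; [apply hol_at_mult|apply hol_at_mult].
    + apply hol_at_plus; [apply hol_at_const|apply hol_at_id].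
    + apply hol_at_exp.
    + apply hol_at_const.
    + apply (hol_at_comp expm1_quot (fun w => s * (w + - p))%C).
      * apply hol_at_mult; [apply hol_at_const|apply hol_at_shift].
      * apply hol_at_expm1_quot, Cmult_neq_0; assumption.
  - unfold exp_quot'. cbv beta. ring.
Qed.

Lemma hol_at_pole_quot (s p w0 : C) : s <> 0 -> w0 <> p -> zeta_quot p w0 <> 0 -> hol_at (pole_quot s p) (pole_quot' s p) w0.
Proof.
  intros Hs H HD. unfold pole_quot. eapply hol_at_eq.
  - apply hol_at_mult; [apply hol_at_exp_quot; assumption|].
    apply hol_at_inv; [exact HD|apply hol_at_zeta_quot, H].
  - unfold pole_quot'. cbv beta. reflexivity.
Qed.

Lemma cont_at_pole_quot' (s p w0 : C) : s <> 0 -> w0 <> p -> zeta_quot p w0 <> 0 -> cont_at (pole_quot' s p) w0.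
Proof.
  intros Hs H HD. apply shift_neq0 in H.
  assert (hsh : cont_at (fun w => s * (w + - p))%C w0)
    by (apply cont_at_mult; [apply cont_at_const|apply cont_at_shift]).
  assert (h1w : cont_at (fun w => (1 + w) * Cexp w)%C w0).
  { apply cont_at_mult; [|apply cont_at_exp].
    apply cont_at_plus; [apply cont_at_const|apply cont_at_id]. }
  unfold pole_quot'. apply cont_at_plus; apply cont_at_mult.
  - unfold exp_quot'. apply cont_at_plus; apply cont_at_mult.
    + apply cont_at_plus; [apply cont_at_exp|exact h1w].
    + apply cont_at_mult; [apply cont_at_const|].
      apply (cont_at_comp expm1_quot); [exact hsh|apply cont_at_expm1_quot].
    + exact h1w.
    + apply cont_at_mult; [apply cont_at_const|]. apply cont_at_mult; [|apply cont_at_const].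
      apply (cont_at_comp expm1_quot'); [exact hsh|]. apply cont_at_expm1_quot', Cmult_neq_0; assumption.
  - apply cont_at_inv; [exact HD|apply cont_at_zeta_quot].
  - apply cont_at_exp_quot.
  - apply cont_at_mult.
    + apply cont_at_opp. unfold zeta_quot'. apply cont_at_mult; [apply cont_at_const|].
      apply cont_at_plus; [apply cont_at_mult; [apply cont_at_const|]|].
      * apply (cont_at_comp expm1_quot'); [apply cont_at_shift|apply cont_at_expm1_quot', H].
      * apply (cont_at_comp Cexp); [apply cont_at_shift|apply cont_at_exp].
    + apply cont_at_inv; [apply Cmult_neq_0; exact HD|].
      apply cont_at_mult; apply cont_at_zeta_quot.
Qed.

(** * Shifting the contour from the cut to a vertical line *)

(** This is v t'(v) / t(v). *)
Definition weight (v : R) : R := v ^ 2 + (1 - vcot v) ^ 2.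

(** The difference between the boundary values, on the upper and the lower edge of
    the cut, of the Cauchy integrand for a pole over [z]. *)
Definition jump (sg : R) (z : C) (v : R) : C :=
  (RtoC (- 2 * sg * weight v * exp (- (1 + sg) * vcot v)) * Ci / (RtoC (boundary_t v) - z))%C.

(** The left side is the derivative of zeta along the boundary curve
    - v cot v + i v, that is t'(v), which is real. *)
Lemma boundary_speed v : 0 < v < PI ->
  ((1 + (- vcot v, v)%R) * Cexp (- vcot v, v)%R * (dvcot v, 1)%R)%C = RtoC (weight v * boundary_t v / v).
Proof.
  intro Hv. set (g := (- vcot v, v) : C).
  assert (Hg : g <> 0) by (unfold g; intro E; injection E; lra).
  assert (Hz : (g * Cexp g)%C = RtoC (boundary_t v)).
  { rewrite <- zeta_eq. apply zeta_boundary. lra. }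
  assert (Ht : ((1 + g) * (dvcot v, 1)%R * RtoC v)%C = (RtoC (weight v) * g)%C).
  { assert (Hs : 0 < sin v) by (apply sin_gt_0; lra).
    assert (Hd : v * dvcot v = v ^ 2 + vcot v ^ 2 - vcot v).
    { unfold dvcot. rewrite vcot_eq by lra. unfold cot.
      assert (t := sin2_cos2 v). unfold Rsqr in t.
      transitivity (v ^ 2 * (sin v * sin v + cos v * cos v) / sin v ^ 2 - v * (cos v / sin v));
        [rewrite t; field; lra|field; lra]. }
    unfold g, weight, Cmult, Cplus, RtoC; simpl.
    apply injective_projections; simpl.
    - transitivity ((1 - vcot v) * (v * dvcot v) - v ^ 2); [ring|rewrite Hd; ring].
    - transitivity ((1 - vcot v) * v + v * (v * dvcot v)); [ring|rewrite Hd; ring]. }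
  assert (HvC : RtoC v <> 0) by (intro E; injection E; lra).
  replace (RtoC (weight v * boundary_t v / v)) with (RtoC (weight v) * RtoC (boundary_t v) / RtoC v)%C
    by (rewrite RtoC_div, RtoC_mult by lra; reflexivity).
  rewrite <- Hz.
  transitivity (((1 + g) * (dvcot v, 1)%R * RtoC v) * Cexp g / RtoC v)%C; [field; exact HvC|].
  rewrite Ht. field. exact HvC.
Qed.

Lemma boundary_t_minus_neq0 v (z : C) : - PI < v < PI -> cut_plane 0 z -> (RtoC (boundary_t v) - z)%C <> 0.
Proof.
  intros Hv Hz E. apply Hz.
  assert (z = RtoC (boundary_t v)) as ->.
  { replace z with (RtoC (boundary_t v) - (RtoC (boundary_t v) - z))%C by ring. rewrite E. ring. }
  simpl. split; [reflexivity|]. left. apply boundary_t_neg, Hv.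
Qed.

(** Conjugate boundary points have the same zeta, namely t(v), and the same real
    speed t'(v). The subtracted constant e^(sg p) therefore cancels, and there
    remains t'(v) / (t(v) - zeta(p)) times the difference of e^(sg w) at the two
    points, which is 2 i e^(- sg v cot v) sin (sg v). *)
Lemma boundary_jump sg p v :
  sg = 1 \/ sg = -1 -> cut_plane 0 (zeta p) -> 0 < v < PI ->
  (pole_quot (RtoC sg) p (- vcot v, v)%R * (dvcot v, 1)%R
   - pole_quot (RtoC sg) p (- vcot v, - v)%R * (dvcot v, -1)%R)%C = jump sg (zeta p) v.
Proof.
  intros Hsg Hc Hv.
  assert (Hz : zeta (- vcot v, v)%R = RtoC (boundary_t v)) by (apply zeta_boundary; lra).
  assert (Hz' : zeta (- vcot v, - v)%R = RtoC (boundary_t v)).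
  { replace ((- vcot v, - v)%R : C) with (Cconj (- vcot v, v)%R) by reflexivity.
    rewrite zeta_conj, Hz. unfold Cconj, RtoC; simpl. f_equal; ring. }
  assert (Hne := boundary_t_minus_neq0 v (zeta p) ltac:(lra) Hc).
  assert (Hne' : RtoC (boundary_t v) <> zeta p).
  { intro E. apply Hne. rewrite E. ring. }
  assert (S1 := boundary_speed v Hv).
  assert (S2 : ((1 + (- vcot v, - v)%R) * Cexp (- vcot v, - v)%R * (dvcot v, -1)%R)%C
               = RtoC (weight v * boundary_t v / v)).
  { apply (f_equal Cconj) in S1. rewrite !Cmult_conj, <- Cexp_conj in S1.
    replace (Cconj (RtoC (weight v * boundary_t v / v))) with (RtoC (weight v * boundary_t v / v)) in S1
      by (unfold Cconj, RtoC; simpl; f_equal; ring).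
    rewrite <- S1.
    replace (Cconj (1 + (- vcot v, v)%R)%C) with (1 + (- vcot v, - v)%R)%C
      by (unfold Cconj, Cplus, RtoC; simpl; f_equal; ring).
    reflexivity. }
  rewrite !pole_quot_eq by (rewrite ?Hz, ?Hz'; exact Hne'). rewrite Hz, Hz'.
  set (g1 := ((- vcot v, v)%R : C)) in *. set (g2 := ((- vcot v, - v)%R : C)) in *.
  transitivity (((1 + g1) * Cexp g1 * (dvcot v, 1)%R * (Cexp (sg * g1) - Cexp (sg * p))
     - (1 + g2) * Cexp g2 * (dvcot v, -1)%R * (Cexp (sg * g2) - Cexp (sg * p)))
     / (RtoC (boundary_t v) - zeta p))%C; [field; exact Hne|].
  rewrite S1, S2.
  transitivity (RtoC (weight v * boundary_t v / v) * (Cexp (sg * g1) - Cexp (sg * g2))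
     / (RtoC (boundary_t v) - zeta p))%C; [field; exact Hne|].
  unfold jump. f_equal.
  assert (Hs := sinc_pos v ltac:(lra)).
  assert (E : (Cexp (sg * g1) - Cexp (sg * g2))%C
     = (RtoC (2 * exp (- sg * vcot v) * (sg * v * sinc v)) * Ci)%C).
  { replace (sg * v * sinc v) with (sg * sin v) by (rewrite sin_sinc; ring).
    assert (E1 : Cexp (sg * g1) = (exp (- sg * vcot v) * cos v, exp (- sg * vcot v) * (sg * sin v))%R).
    { unfold Cexp, g1; simpl.
      replace (sg * - vcot v - 0 * v) with (- sg * vcot v) by ring.
      replace (sg * v + 0 * - vcot v) with (sg * v) by ring.
      destruct Hsg as [->| ->].
      - rewrite !Rmult_1_l. reflexivity.
      - replace (-1 * v) with (- v) by ring. rewrite cos_neg, sin_neg. f_equal. ring. }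
    assert (E2 : Cexp (sg * g2) = (exp (- sg * vcot v) * cos v, - (exp (- sg * vcot v) * (sg * sin v)))%R).
    { unfold Cexp, g2; simpl.
      replace (sg * - vcot v - 0 * - v) with (- sg * vcot v) by ring.
      replace (sg * - v + 0 * - vcot v) with (- (sg * v)) by ring. rewrite cos_neg, sin_neg.
      destruct Hsg as [->| ->].
      - rewrite !Rmult_1_l. f_equal. ring.
      - replace (-1 * v) with (- v) by ring. rewrite cos_neg, sin_neg. f_equal. ring. }
    rewrite E1, E2. unfold Cminus, Cplus, Copp, Cmult, Ci, RtoC; simpl. f_equal; ring. }
  rewrite E, Cmult_assoc, <- RtoC_mult. f_equal. f_equal.
  unfold boundary_t. replace (- (1 + sg) * vcot v) with (- vcot v + - sg * vcot v) by ring.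
  rewrite exp_plus. field. lra.
Qed.

Lemma seg_lambert_domain b x s eps : 0 < b < PI -> 0 <= x <= b -> 0 <= s <= 1 -> eps = 1 \/ eps = -1 ->
  lambert_domain (seg (fun u => - vcot u)%R (- vcot b)%R eps x s).
Proof.
  intros Hb Hx Hs He. assert (m := vcot_decr x b ltac:(lra) ltac:(lra)).
  assert (Hpi := PI_RGT_0).
  unfold lambert_domain, seg; simpl.
  assert (E : vcot (eps * x) = vcot x).
  { destruct He as [->| ->]; [f_equal; ring|]. rewrite <- vcot_even. f_equal; ring. }
  rewrite E. split; [destruct He as [->| ->]; lra|]. nra.
Qed.

Lemma locally_open_except v b e : 0 < v < b -> v <> e -> locally v (fun x => 0 < x < b /\ x <> e).
Proof.
  intros Hv He.
  assert (Hp : 0 < Rmin (Rmin v (b - v)) (Rabs (v - e))).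
  { repeat apply Rmin_pos; try lra. apply Rabs_pos_lt. lra. }
  exists (mkposreal _ Hp). intros y Hy.
  unfold ball in Hy; simpl in Hy; unfold AbsRing_ball, abs, minus, plus, opp in Hy; simpl in Hy.
  assert (g1 := Rmin_l (Rmin v (b - v)) (Rabs (v - e))).
  assert (g2 := Rmin_r (Rmin v (b - v)) (Rabs (v - e))).
  assert (g3 := Rmin_l v (b - v)). assert (g4 := Rmin_r v (b - v)).
  split.
  - apply Rabs_def2 in Hy. lra.
  - intros ->. rewrite <- Rabs_Ropp in Hy.
    replace (- (e + - v)) with (v - e) in Hy by ring. lra.
Qed.

(** The integral of [H] along the horizontal segment at height [eps * x] from the
    boundary curve to the line Re w = - b cot b. The factor [c] gives access to
    both real and imaginary parts through real-valued integrals. *)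
Definition slice (H : C -> C) (b eps : R) (c : C) (x : R) : R :=
  RInt (fun s => Re (c * (H (seg (fun u => - vcot u)%R (- vcot b)%R eps x s)
                          * RtoC (- vcot b - - vcot x)))%C) 0 1.

Lemma slice_continuous sg p b eps c :
  lambert_domain p -> cut_plane 0 (zeta p) -> 0 < b < PI -> eps = 1 \/ eps = -1 ->
  forall x, continuity_pt (fun y => slice (pole_quot sg p) b eps c (clip 0 b y)) x.
Proof.
  intros Hp Hc Hb He.
  apply (RInt_param_clip_continuous (fun x s =>
    Re (c * (pole_quot sg p (seg (fun u => - vcot u)%R (- vcot b)%R eps x s) * RtoC (- vcot b - - vcot x)))%C));
    [lra|].
  intros x s Hx Hs. apply (flux_continuity_2d (pole_quot sg p) (fun u => - vcot u)).
  - apply (continuous_opp (V := R_NormedModule)), vcot_continuous; lra.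
  - apply cont_at_pole_quot, zeta_quot_neq0; try assumption. apply seg_lambert_domain; assumption.
Qed.

(** The segment avoids the removable singularity p unless its height is |Im p|. *)
Lemma slice_derive (sg p : C) b eps c v :
  sg <> 0 -> lambert_domain p -> cut_plane 0 (zeta p) -> 0 < b < PI -> eps = 1 \/ eps = -1 ->
  0 < v < b -> v <> Rabs (Im p) ->
  is_derive (slice (pole_quot sg p) b eps c) v
    (Re (c * (pole_quot sg p (- vcot b, eps * v)%R * (0, eps)%R
              - pole_quot sg p (- vcot v, eps * v)%R * (dvcot v, eps)%R))%C).
Proof.
  intros Hsg Hp Hc Hb He Hv Hvp.
  assert (L := locally_open_except v b _ Hv Hvp).
  assert (Hne : forall x s, 0 < x -> x <> Rabs (Im p) ->
     seg (fun u => - vcot u)%R (- vcot b)%R eps x s <> p).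
  { intros x s h0 h E. apply h. rewrite <- E. simpl.
    destruct He as [->| ->]; rewrite Rabs_mult, (Rabs_pos_eq x) by lra.
    - rewrite Rabs_R1. ring.
    - rewrite Rabs_left by lra. ring. }
  assert (Hac : forall x, 0 < x < PI -> continuous (fun u => - vcot u) x).
  { intros x hx. apply (continuous_opp (V := R_NormedModule)), vcot_continuous; lra. }
  eapply is_derive_eq.
  - apply (flux_derive (pole_quot sg p) (pole_quot' sg p) (fun u => - vcot u) dvcot (- vcot b) eps c v).
    + generalize L. apply filter_imp. intros x [hx _] s hs.
      apply cont_at_pole_quot, zeta_quot_neq0; try assumption. apply seg_lambert_domain; try assumption; lra.
    + generalize L. apply filter_imp. intros x [hx hx'] s hs.
      apply hol_at_pole_quot; [exact Hsg|apply Hne; [lra|exact hx']|].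
      apply zeta_quot_neq0; try assumption. apply seg_lambert_domain; try assumption; lra.
    + intros s hs. apply locally_2d_locally.
      assert (cs := seg_cont (fun u => - vcot u) (- vcot b) eps v s (Hac v ltac:(lra))).
      assert (l1 := locally_neq0 (fun q : R * R =>
        zeta_quot p (seg (fun u => - vcot u)%R (- vcot b)%R eps (fst q) (snd q))) (v, s)
        (cont_at_zeta_quot p _ _ _ _ eq_refl cs)
        (zeta_quot_neq0 _ _ Hp (seg_lambert_domain b v s eps Hb ltac:(lra) hs He) Hc)).
      assert (l2 := locally_neq0 (fun q : R * R =>
        seg (fun u => - vcot u)%R (- vcot b)%R eps (fst q) (snd q) + - p)%C (v, s)
        (cont_at_shift p _ _ _ _ eq_refl cs)
        (shift_neq0 _ _ (Hne v s (proj1 Hv) Hvp))).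
      generalize (filter_and _ _ l1 l2). apply filter_imp. intros q [n1 n2].
      apply hol_at_pole_quot; [exact Hsg| |exact n1].
      intro E. apply n2. etransitivity; [apply (f_equal (fun u => u + - p)%C E)|cbv beta; ring].
    + intros s hs. apply cont_at_pole_quot'; [exact Hsg|apply Hne; [lra|exact Hvp]|].
      apply zeta_quot_neq0; try assumption. apply seg_lambert_domain; try assumption; lra.
    + generalize L. apply filter_imp. intros x [hx _]. apply dvcot_derive. lra.
    + apply dvcot_continuous. lra.
  - do 3 f_equal; f_equal; unfold seg; apply f_equal; apply f_equal2; ring.
Qed.

Lemma jump_continuous sg z v : - PI < v < PI -> cut_plane 0 z -> Ccont (jump sg z) v.
Proof.
  intros Hv Hz. unfold jump.
  assert (hv := vcot_continuous v Hv). assert (Hs := sinc_pos v Hv).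
  apply Ccont_mult; [apply Ccont_mult; [|apply Ccont_const]|apply Ccont_inv].
  - apply Ccont_pair; [|apply continuous_const].
    apply (continuous_mult (K := R_AbsRing)).
    + apply (continuous_mult (K := R_AbsRing)); [apply continuous_const|].
      unfold weight. apply (continuous_plus (V := R_NormedModule)).
      * apply (continuous_real_comp (fun u => u ^ 2) (fun u => u)); [apply continuous_id|auto_derive; trivial].
      * apply (continuous_real_comp (fun u => (1 - u) ^ 2) vcot); [exact hv|auto_derive; trivial].
    + apply (continuous_real_comp (fun u => exp (- (1 + sg) * u)) vcot); [exact hv|auto_derive; trivial].
  - apply boundary_t_minus_neq0; assumption.
  - apply Ccont_plus; [|apply Ccont_const]. apply Ccont_pair; [|apply continuous_const].
    unfold boundary_t. apply (continuous_mult (K := R_AbsRing) (fun u => - exp (- vcot u))).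
    + apply (continuous_real_comp (fun u => - exp (- u)) vcot); [exact hv|auto_derive; trivial].
    + apply (continuous_real_comp Rinv sinc); [apply sinc_continuous|]. auto_derive. lra.
Qed.

(** Cauchy's theorem on the region between the boundary curve and the vertical
    line. The upper slice minus the lower slice vanishes at height 0, where the
    two coincide, and at height b, where they shrink to a point; its derivative
    is the integrand. *)
Lemma Cauchy_one_pole sg p b c :
  sg = 1 \/ sg = -1 -> lambert_domain p -> cut_plane 0 (zeta p) -> 0 < b < PI ->
  is_RInt (fun v => Re (c * (pole_quot (RtoC sg) p (- vcot b, v)%R * Ci
                          + pole_quot (RtoC sg) p (- vcot b, - v)%R * Ci - jump sg (zeta p) v))%C) 0 b 0.
Proof.
  intros Hsg Hp Hc Hb.
  assert (HsC : RtoC sg <> 0) by (intro E; injection E; lra).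
  set (f := fun v => Re (c * (pole_quot (RtoC sg) p (- vcot b, v)%R * Ci
                          + pole_quot (RtoC sg) p (- vcot b, - v)%R * Ci - jump sg (zeta p) v))%C).
  assert (Hcont : forall x, 0 <= x <= b -> continuous f x).
  { intros x Hx. apply Ccont_scal_re. apply Ccont_plus; [|apply Ccont_opp, jump_continuous; [lra|exact Hc]].
    assert (h : forall eps, eps = 1 \/ eps = -1 ->
              Ccont (fun v => pole_quot sg p (- vcot b, eps * v)%R * Ci)%C x).
    { intros eps He. apply Ccont_mult; [|apply Ccont_const].
      apply (cont_at_pole_quot sg p (- vcot b, eps * x)%R).
      - apply zeta_quot_neq0; try assumption.
        assert (D := seg_lambert_domain b x 1 eps Hb Hx ltac:(lra) He). unfold seg in D.
        replace (- vcot x + 1 * (- vcot b - - vcot x)) with (- vcot b) in D by ring. exact D.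
      - reflexivity.
      - apply Ccont_pair; [apply continuous_const|].
        apply (continuous_mult (K := R_AbsRing)); [apply continuous_const|apply continuous_id]. }
    apply Ccont_plus.
    + generalize (h 1 (or_introl eq_refl)). intros [k1 k2]. split;
        [eapply continuous_ext; [|exact k1]|eapply continuous_ext; [|exact k2]];
        intro v; cbv beta; rewrite Rmult_1_l; reflexivity.
    + generalize (h (-1) (or_intror eq_refl)). intros [k1 k2]. split;
        [eapply continuous_ext; [|exact k1]|eapply continuous_ext; [|exact k2]];
        intro v; cbv beta; replace (-1 * v) with (- v) by ring; reflexivity. }
  assert (Hex : ex_RInt f 0 b).
  { apply (ex_RInt_continuous (V := R_CompleteNormedModule)).
    rewrite Rmin_left, Rmax_right by lra. exact Hcont. }
  assert (HI : RInt f 0 b = 0).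
  2: { assert (h := RInt_correct (V := R_CompleteNormedModule) f 0 b Hex).
       rewrite HI in h. exact h. }
  set (P := fun y => slice (pole_quot sg p) b 1 c y - slice (pole_quot sg p) b (-1) c y).
  rewrite (RInt_derive_except (fun y => P (clip 0 b y)) f (Rabs (Im p)) 0 b);
    [| lra| |exact Hcont|].
  - rewrite !clip_id by lra. unfold P.
    assert (Pb : forall eps, slice (pole_quot sg p) b eps c b = 0).
    { intro eps. unfold slice. rewrite (RInt_ext _ (fun _ => 0)).
      - rewrite RInt_const. apply Rmult_0_r.
      - intros s _. replace (- vcot b - - vcot b) with 0 by ring. rewrite !Cmult_0_r. reflexivity. }
    assert (P0 : slice (pole_quot sg p) b 1 c 0 = slice (pole_quot sg p) b (-1) c 0).
    { unfold slice, seg. rewrite !Rmult_0_r. reflexivity. }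
    rewrite !Pb, P0, !Rminus_diag. reflexivity.
  - intros x Hx. unfold P. apply continuity_pt_minus; apply slice_continuous; auto.
  - intros x Hx Hxp.
    assert (d1 := slice_derive sg p b 1 c x HsC Hp Hc Hb ltac:(auto) Hx Hxp).
    assert (d2 := slice_derive sg p b (-1) c x HsC Hp Hc Hb ltac:(auto) Hx Hxp).
    apply (is_derive_ext_loc P).
    { generalize (locally_open_except x b _ Hx Hxp). apply filter_imp. intros y [hy _].
      rewrite clip_id by lra. reflexivity. }
    eapply is_derive_eq.
    + apply (is_derive_minus (V := R_NormedModule)); [exact d1|exact d2].
    + unfold f. rewrite <- (boundary_jump sg p x Hsg Hc ltac:(lra)).
      rewrite !Rmult_1_l. replace (-1 * x) with (- x) by ring.
      unfold minus, plus, opp; simpl. unfold Re, Im; simpl. ring.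
Qed.

(** * Decay to the right, and the kernel up to v = PI *)

Lemma Cmod_Cexp w : Cmod (Cexp w) = exp (Re w).
Proof.
  assert (h : Cmod (Cexp w) ^ 2 = exp (Re w) ^ 2).
  { rewrite Cmod2_alt. unfold Cexp; simpl. assert (t := sin2_cos2 (Im w)). unfold Rsqr in t.
    transitivity (exp (Re w) ^ 2 * (sin (Im w) * sin (Im w) + cos (Im w) * cos (Im w)));
      [ring|rewrite t; ring]. }
  assert (h1 := Cmod_ge_0 (Cexp w)). assert (h2 := exp_pos (Re w)). 
  apply (Rsqr_inj); unfold Rsqr; lra.
Qed.

(** The difference equals (1 + w) (e^(sg w) - e^(sg p)) zeta(p) divided by
    w (zeta(w) - zeta(p)); the growth of e^(sg w) is absorbed by that of w e^w,
    which leaves a factor 1 / Re w. *)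
Lemma pole_quot_far sg p : sg = 1 \/ sg = -1 -> exists M R0, 0 <= M /\ 1 <= R0 /\
  forall w, R0 <= Re w ->
  Cmod (pole_quot (RtoC sg) p w - (1 + / w) * (Cexp (sg * w) - Cexp (sg * p)))%C <= M / Re w.
Proof.
  intro Hsg. set (z := zeta p). set (G := Cmod (Cexp (sg * p))).
  assert (HG : 0 <= G) by apply Cmod_ge_0. assert (Hz := Cmod_ge_0 z).
  exists (4 * (1 + G) * Cmod z), (Rmax 1 (2 * Cmod z)).
  split; [repeat apply Rmult_le_pos; lra|]. split; [apply Rmax_l|].
  intros w Hw. set (r := Re w) in *.
  assert (Hr1 : 1 <= r) by (eapply Rle_trans; [apply Rmax_l|exact Hw]).
  assert (Hr2 : 2 * Cmod z <= r) by (eapply Rle_trans; [apply Rmax_r|exact Hw]).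
  assert (Hwr : r <= Cmod w).
  { eapply Rle_trans; [|apply re_le_Cmod]. apply Rle_abs. }
  assert (He : 1 <= exp r) by (assert (h := exp_ineq1_le r); lra).
  assert (Hzw : Cmod (zeta w) = Cmod w * exp r).
  { rewrite zeta_eq, Cmod_mult, Cmod_Cexp. reflexivity. }
  assert (Hden : Cmod w * exp r / 2 <= Cmod (zeta w - z)%C).
  { assert (t := Cmod_triangle (zeta w - z) z).
    replace (zeta w - z + z)%C with (zeta w) in t by ring. rewrite Hzw in t. nra. }
  assert (Hwe : 0 < Cmod w * exp r) by nra.
  assert (Hw0 : w <> 0) by (apply Cmod_gt_0; lra).
  assert (Hd0 : (zeta w - z)%C <> 0) by (apply Cmod_gt_0; lra).
  assert (Hne : zeta w <> zeta p).
  { intro E. apply Hd0. unfold z. rewrite E. ring. }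
  rewrite pole_quot_eq by exact Hne.
  set (D := (Cexp (sg * w) - Cexp (sg * p))%C).
  assert (HD : Cmod D <= exp r * (1 + G)).
  { unfold D. eapply Rle_trans; [apply Cmod_triangle|]. rewrite Cmod_opp. fold G.
    rewrite Cmod_Cexp. 
    assert (exp (Re (sg * w)) <= exp r).
    { assert (E : Re (sg * w) = sg * r) by (unfold r; simpl; unfold Re; ring). rewrite E.
      destruct Hsg as [->| ->]; [rewrite Rmult_1_l; lra|]. left. apply exp_increasing. lra. }
    nra. }
  replace ((1 + w) * Cexp w * D / (zeta w - zeta p) - (1 + / w) * D)%C
    with ((1 + w) * D * z / (w * (zeta w - z)))%C.
  2: { fold z. rewrite (zeta_eq w) in *. field. split; [exact Hw0|exact Hd0]. }
  rewrite Cmod_div by (apply Cmult_neq_0; assumption). rewrite !Cmod_mult.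
  assert (H1w : Cmod (1 + w)%C <= 2 * Cmod w).
  { eapply Rle_trans; [apply Cmod_triangle|]. rewrite Cmod_1. lra. }
  assert (Hw1 := Cmod_ge_0 (1 + w)%C). assert (HD0 := Cmod_ge_0 D).
  assert (Hnum : Cmod (1 + w)%C * Cmod D * Cmod z <= 2 * Cmod w * (exp r * (1 + G)) * Cmod z).
  { apply Rmult_le_compat_r; [exact Hz|]. apply Rmult_le_compat; assumption. }
  assert (Hdd : 0 < Cmod w * Cmod (zeta w - z)%C) by (apply Rmult_lt_0_compat; lra).
  apply Rle_div_l; [exact Hdd|].
  eapply Rle_trans; [exact Hnum|].
  replace (2 * Cmod w * (exp r * (1 + G)) * Cmod z)
    with (4 * (1 + G) * Cmod z / r * (Cmod w * (r * exp r / 2))) by (field; lra).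
  apply Rmult_le_compat_l.
  { apply Rdiv_le_0_compat; [repeat apply Rmult_le_pos; lra|lra]. }
  apply Rmult_le_compat_l; [lra|].
  eapply Rle_trans; [|exact Hden]. nra.
Qed.

(** As v tends to PI, v cot v tends to minus infinity; hence the value 0 at PI. *)
Definition exp_vcot_ext (v : R) : R := if Rlt_dec v PI then exp (vcot v) else 0.
(** The reciprocal of [t], which tends to 0 at PI, where [t] is infinite. Written
    in terms of it, the kernel extends continuously to PI: see [K_ext]. *)
Definition inv_t (v : R) : R := - sinc v * exp_vcot_ext v.
Definition weight_ext (v : R) : R := sin v ^ 2 + (sinc v - cos v) ^ 2.
(** With r = 1/t this is K(z, v) e^(-2 v cot v): after multiplying numerator and
    denominator by r^3, the factor r^2 e^(-2 v cot v) is [sinc v ^ 2], which turns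
    [weight] into [weight_ext]. *)
Definition K_ext (z : C) (v : R) : C :=
  ((RtoC (inv_t v) + z) * RtoC (weight_ext v) * / ((z * RtoC (inv_t v) - 1) * RtoC (1 + inv_t v ^ 2)))%C.

Lemma sinc_cos_continuous_PI : continuous (fun v => sinc v / cos v) PI.
Proof.
  apply (continuous_mult (K := R_AbsRing)); [apply sinc_continuous|].
  apply (continuous_real_comp (fun u => / cos u) (fun u => u)); [apply continuous_id|].
  auto_derive. rewrite cos_PI. lra.
Qed.

Lemma locally_PI_cos : locally PI (fun v => PI / 2 < v /\ cos v < 0).
Proof.
  assert (h := PI2_3_2).
  exists (mkposreal 1 Rlt_0_1). intros y Hy.
  unfold ball in Hy; simpl in Hy; unfold AbsRing_ball, abs, minus, plus, opp in Hy; simpl in Hy.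
  apply Rabs_def2 in Hy. split; [lra|]. apply cos_lt_0; lra.
Qed.

Lemma exp_vcot_ext_continuous v : 0 <= v <= PI -> continuous exp_vcot_ext v.
Proof.
  intro Hv. assert (Hpi := PI_RGT_0). destruct (Rlt_dec v PI) as [h|h].
  - apply (continuous_ext_loc _ (fun u => exp (vcot u))).
    + exists (mkposreal (PI - v) ltac:(lra)). intros y Hy.
      unfold ball in Hy; simpl in Hy; unfold AbsRing_ball, abs, minus, plus, opp in Hy; simpl in Hy.
      apply Rabs_def2 in Hy. unfold exp_vcot_ext. destruct Rlt_dec; [reflexivity|lra].
    + apply (continuous_real_comp exp vcot); [apply vcot_continuous; lra|auto_derive; trivial].
  - assert (v = PI) as -> by lra.
    assert (E : exp_vcot_ext PI = 0) by (unfold exp_vcot_ext; destruct Rlt_dec; [lra|reflexivity]).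
    assert (Hb : locally PI (fun u => Rabs (exp_vcot_ext u) <= Rabs (sinc u / cos u))).
    { generalize locally_PI_cos. apply filter_imp. intros u [h1 h2]. unfold exp_vcot_ext.
      destruct Rlt_dec as [hu|hu]; [|rewrite Rabs_R0; apply Rabs_pos].
      rewrite Rabs_pos_eq by (left; apply exp_pos).
      assert (hs := sinc_pos u ltac:(lra)).
      set (x := vcot u). assert (hx : 0 < - x).
      { unfold x, vcot. assert (0 < / sinc u) by (apply Rinv_0_lt_compat; exact hs).
        unfold Rdiv. nra. }
      assert (hxx : sinc u / cos u = - / (- x)).
      { unfold x, vcot. field. lra. }
      rewrite hxx, Rabs_Ropp, Rabs_pos_eq by (left; apply Rinv_0_lt_compat; exact hx).
      replace (exp x) with (/ exp (- x)) by (rewrite <- exp_Ropp; f_equal; ring).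
      apply Rinv_le_contravar; [exact hx|]. assert (g := exp_ineq1_le (- x)). lra. }
    intros P [eps HP]. unfold filtermap.
    generalize (filter_and _ _ Hb (continuous_Rabs_lt _ _ eps sinc_cos_continuous_PI)).
    apply filter_imp. intros u [u1 u2]. apply HP. rewrite E.
    rewrite sinc_PI in u2. unfold Rdiv at 2 in u2. rewrite Rmult_0_l, Rminus_0_r in u2.
    unfold ball; simpl; unfold AbsRing_ball, abs, minus, plus, opp; simpl.
    rewrite Ropp_0, Rplus_0_r. lra.
Qed.

Lemma inv_t_nonpos v : 0 <= v <= PI -> inv_t v <= 0.
Proof.
  intro Hv. assert (Hpi := PI_RGT_0). unfold inv_t, exp_vcot_ext. destruct Rlt_dec; [|lra].
  assert (h := sinc_pos v ltac:(lra)). assert (g := exp_pos (vcot v)). nra.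
Qed.

(** The real number r = [inv_t v] is at most 0, and z r = 1 would make z = 1/r a
    negative real number. *)
Lemma K_ext_den z v : cut_plane 0 z -> 0 <= v <= PI -> (z * RtoC (inv_t v) - 1)%C <> 0.
Proof.
  intros Hz Hv E. assert (h := inv_t_nonpos v Hv).
  assert (E1 : (z * RtoC (inv_t v))%C = 1).
  { replace (z * RtoC (inv_t v))%C with ((z * RtoC (inv_t v) - 1) + 1)%C by ring. rewrite E. ring. }
  destruct z as [x y]. unfold Cmult, RtoC in E1; simpl in E1. injection E1 as e1 e2.
  apply Hz. simpl. assert (y * inv_t v = 0) by lra. 
  assert (hr : inv_t v <> 0) by (intro q; rewrite q in e1; lra).
  split; [apply Rmult_integral in H; tauto|]. 
  assert (x * inv_t v = 1) by lra. nra.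
Qed.

Lemma K_ext_continuous z v : cut_plane 0 z -> 0 <= v <= PI -> Ccont (K_ext z) v.
Proof.
  intros Hz Hv. assert (he := exp_vcot_ext_continuous v Hv). assert (hs := sinc_continuous v).
  assert (hr : continuous inv_t v).
  { unfold inv_t. apply (continuous_mult (K := R_AbsRing) (fun u => - sinc u)); [|exact he].
    apply (continuous_opp (V := R_NormedModule)); exact hs. }
  assert (hrC : Ccont (fun u => RtoC (inv_t u)) v) by (apply Ccont_pair; [exact hr|apply continuous_const]).
  unfold K_ext. apply Ccont_mult; [apply Ccont_mult|apply Ccont_inv].
  - apply Ccont_plus; [exact hrC|apply Ccont_const].
  - apply Ccont_pair; [|apply continuous_const]. unfold weight_ext.
    apply (continuous_plus (V := R_NormedModule)).
    + apply (continuous_real_comp (fun u => sin u ^ 2) (fun u => u)); [apply continuous_id|auto_derive; trivial].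
    + apply (continuous_real_comp (fun u => u ^ 2) (fun u => sinc u - cos u)); [|auto_derive; trivial].
      apply (continuous_minus (V := R_NormedModule)); [exact hs|].
      apply (continuous_real_comp cos (fun u => u)); [apply continuous_id|auto_derive; trivial].
  - apply Cmult_neq_0; [apply K_ext_den; assumption|].
    intro E. injection E. assert (g := pow2_ge_0 (inv_t v)). lra.
  - apply Ccont_mult.
    + apply Ccont_plus; [apply Ccont_mult; [apply Ccont_const|exact hrC]|apply Ccont_const].
    + apply Ccont_pair; [|apply continuous_const].
      apply (continuous_plus (V := R_NormedModule)); [apply continuous_const|].
      apply (continuous_real_comp (fun u => u ^ 2) inv_t); [exact hr|auto_derive; trivial].
Qed.

Lemma t_eq_boundary_t v : 0 < v < PI -> t v = boundary_t v.
Proof.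
  intro Hv. assert (Hs : 0 < sin v) by (apply sin_gt_0; lra).
  unfold t, boundary_t, csc. rewrite vcot_eq, sinc_eq by lra.
  replace (- v * cot v) with (- (v * cot v)) by ring. field. lra.
Qed.

Lemma K_times_exp_eq_K_ext z v : cut_plane 0 z -> 0 < v < PI ->
  (K z v * RtoC (exp (- 2 * vcot v)))%C = K_ext z v.
Proof.
  intros Hz Hv.
  assert (Hs := sinc_pos v ltac:(lra)). assert (Hd := K_ext_den z v Hz ltac:(lra)).
  assert (Hr : inv_t v = / boundary_t v).
  { unfold inv_t, boundary_t, exp_vcot_ext. destruct Rlt_dec; [|lra]. rewrite exp_Ropp. field.
    split; apply Rgt_not_eq; first [apply exp_pos|exact Hs]. }
  assert (Ht := boundary_t_neg v ltac:(lra)).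
  assert (HM : weight_ext v = (v ^ 2 + (1 - v * cot v) ^ 2) * sinc v ^ 2).
  { rewrite <- vcot_eq by exact Hv. unfold weight_ext. rewrite sin_sinc. unfold vcot. field. lra. }
  assert (HE : sinc v ^ 2 = exp (- 2 * vcot v) * / (boundary_t v ^ 2)).
  { unfold boundary_t. replace (- 2 * vcot v) with (- vcot v + - vcot v) by ring. rewrite exp_plus.
    assert (g := exp_pos (- vcot v)). field. split; lra. }
  unfold K, K_ext. rewrite t_eq_boundary_t by exact Hv. rewrite HM, HE, !Hr in *.
  set (T := boundary_t v) in *. set (e := exp (- 2 * vcot v)).
  set (n := v ^ 2 + (1 - v * cot v) ^ 2).
  assert (HT : RtoC T <> 0) by (intro E; injection E; lra).
  assert (H1 : RtoC (1 + T ^ 2) <> 0).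
  { intro E. injection E. assert (g := pow2_ge_0 T). lra. }
  rewrite RtoC_inv in * by lra.
  replace (RtoC (n * (e * / T ^ 2))) with (RtoC n * RtoC e / (RtoC T * RtoC T))%C.
  2: { rewrite !RtoC_mult, RtoC_inv by (apply pow_nonzero; lra).
       replace (T ^ 2) with (T * T) by ring. rewrite RtoC_mult. field. exact HT. }
  replace (RtoC (1 + (/ T) ^ 2)) with (RtoC (1 + T ^ 2) / (RtoC T * RtoC T))%C.
  2: { replace (1 + (/ T) ^ 2) with ((1 + T ^ 2) * / (T * T)) by (field; lra).
       rewrite RtoC_mult, RtoC_inv, RtoC_mult by nra. reflexivity. }
  assert (Hd' : (z - RtoC T)%C <> 0).
  { intro E. apply Hd. replace z with ((z - RtoC T) + RtoC T)%C by ring. rewrite E. field. exact HT. }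
  field. repeat split; try assumption.
Qed.

(** * The limit of the contour shift *)

(** Both sides of the estimate are continuous at b = PI and sinc PI = 0, so the
    estimate becomes an equality there. *)
Lemma RInt_limit_PI (f : R -> R) kappa Cst b0 :
  (forall v, 0 <= v <= PI -> continuous f v) -> 0 <= b0 < PI ->
  (forall b, b0 < b < PI -> Rabs (RInt f 0 b - b * kappa) <= Cst * Rabs (sinc b / cos b)) ->
  RInt f 0 PI = PI * kappa.
Proof.
  intros Hf Hb0 HI. assert (Hpi := PI_RGT_0).
  set (g := fun x => f (clip 0 PI x)).
  assert (Hg : forall x, continuous g x).
  { intro x. apply (continuous_comp (clip 0 PI) f); [apply clip_continuous|].
    apply Hf, clip_range; lra. }
  assert (Hfg : forall b, 0 <= b <= PI -> RInt f 0 b = RInt g 0 b).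
  { intros b Hb. apply RInt_ext. rewrite Rmin_left, Rmax_right by lra. intros x Hx.
    unfold g. rewrite clip_id by lra. reflexivity. }
  (* [k] is at most 0 to the left of PI and continuous at PI *)
  set (k := fun b => Rabs (RInt g 0 b - b * kappa) - Cst * Rabs (sinc b / cos b)).
  assert (Hk : continuous k PI).
  { unfold k. apply (continuous_minus (V := R_NormedModule)).
    - apply (continuous_comp (fun b => RInt g 0 b - b * kappa) Rabs); [|apply continuous_Rabs].
      apply (continuous_minus (V := R_NormedModule)).
      + apply (ex_derive_continuous (V := R_NormedModule)). eexists.
        apply (is_derive_RInt (V := R_NormedModule) g _ 0); [|apply Hg].
        apply filter_forall. intro y. apply (RInt_correct (V := R_CompleteNormedModule)).
        apply (ex_RInt_continuous (V := R_CompleteNormedModule)). intros; apply Hg.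
      + apply (continuous_mult (K := R_AbsRing)); [apply continuous_id|apply continuous_const].
    - apply (continuous_mult (K := R_AbsRing)); [apply continuous_const|].
      apply (continuous_comp (fun b => sinc b / cos b) Rabs); [|apply continuous_Rabs].
      apply sinc_cos_continuous_PI. }
  assert (Ek : k PI = Rabs (RInt g 0 PI - PI * kappa)).
  { unfold k. rewrite sinc_PI. unfold Rdiv. rewrite Rmult_0_l, Rabs_R0. ring. }
  rewrite Hfg by lra. apply Rminus_diag_uniq.
  destruct (Req_dec (RInt g 0 PI - PI * kappa) 0) as [e|e]; [exact e|exfalso].
  assert (hp : 0 < k PI) by (rewrite Ek; apply Rabs_pos_lt; exact e).
  destruct (continuous_Rabs_lt _ _ (mkposreal _ hp) Hk) as [d Hd]. simpl in Hd.
  set (b := PI - Rmin d (PI - b0) / 2).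
  assert (m1 := Rmin_l d (PI - b0)). assert (m2 := Rmin_r d (PI - b0)).
  assert (m3 : 0 < Rmin d (PI - b0)) by (apply Rmin_pos; [apply cond_pos|lra]).
  assert (Hb : b0 < b < PI) by (unfold b; lra).
  assert (hb : ball PI d b).
  { unfold ball; simpl; unfold AbsRing_ball, abs, minus, plus, opp; simpl.
    unfold b. rewrite Rabs_left; lra. }
  specialize (Hd b hb). apply Rabs_def2 in Hd.
  assert (h := HI b Hb). rewrite Hfg in h by lra. fold (k b) in Hd.
  assert (k b <= 0) by (unfold k; lra). lra.
Qed.

(** The reciprocal of - b cot b extends continuously to b = PI by the value 0. *)
Lemma neg_vcot_large_near_PI (R0 : R) : 1 <= R0 -> exists b0, PI / 2 <= b0 < PI /\ forall b, b0 < b < PI ->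
  R0 <= - vcot b /\ / (- vcot b) = Rabs (sinc b / cos b).
Proof.
  intro HR. assert (Hpi := PI_RGT_0).
  assert (hp : 0 < / R0) by (apply Rinv_0_lt_compat; lra).
  destruct (filter_and _ _ locally_PI_cos
    (continuous_Rabs_lt _ _ (mkposreal _ hp) sinc_cos_continuous_PI)) as [d Hd].
  simpl in Hd.
  exists (PI - Rmin d (PI / 2)).
  assert (m1 := Rmin_l d (PI / 2)). assert (m2 := Rmin_r d (PI / 2)).
  assert (m3 : 0 < Rmin d (PI / 2)) by (apply Rmin_pos; [apply cond_pos|lra]).
  split; [lra|]. intros b Hb.
  assert (hb : ball PI d b).
  { unfold ball; simpl; unfold AbsRing_ball, abs, minus, plus, opp; simpl.
    rewrite Rabs_left; lra. }
  destruct (Hd b hb) as [[h1 h2] h3].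
  rewrite sinc_PI in h3. unfold Rdiv at 2 in h3. rewrite Rmult_0_l, Rminus_0_r in h3.
  assert (hs := sinc_pos b ltac:(lra)).
  assert (E : sinc b / cos b = - / (- vcot b)) by (unfold vcot; field; lra).
  assert (hv : 0 < - vcot b).
  { unfold vcot. assert (0 < / sinc b) by (apply Rinv_0_lt_compat; exact hs).
    unfold Rdiv. nra. }
  assert (E2 : / (- vcot b) = Rabs (sinc b / cos b)).
  { rewrite E, Rabs_Ropp, Rabs_pos_eq; [reflexivity|]. left. apply Rinv_0_lt_compat, hv. }
  split; [|exact E2]. rewrite <- E2 in h3.
  apply Rlt_le. rewrite <- (Rinv_inv R0), <- (Rinv_inv (- vcot b)).
  apply Rinv_lt_contravar; [|exact h3].
  apply Rmult_lt_0_compat; [apply Rinv_0_lt_compat, hv|exact hp].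
Qed.

(** The weights 1, -1/2, -1/2 at z, i, -i produce
    1/(t-z) - t/(t^2+1) = (1 + z t)/((t-z)(1+t^2)), the z-dependence of K. *)
Lemma jump_sum sg z v : 0 < v < PI -> cut_plane 0 z ->
  (jump sg z v - / 2 * jump sg Ci v - / 2 * jump sg (- Ci) v)%C
  = (RtoC (2 * sg) * Ci * (K z v * RtoC (exp (- (1 + sg) * vcot v))))%C.
Proof.
  intros Hv Hz. unfold jump, K. rewrite t_eq_boundary_t by exact Hv.
  rewrite <- vcot_eq by exact Hv. fold (weight v).
  set (T := boundary_t v). set (e := exp (- (1 + sg) * vcot v)).
  assert (H0 : (RtoC T - z)%C <> 0) by (apply boundary_t_minus_neq0; [lra|exact Hz]).
  assert (H0' : (z - RtoC T)%C <> 0).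
  { intro E. apply H0. replace (RtoC T - z)%C with (- (z - RtoC T))%C by ring. rewrite E. ring. }
  assert (H1 : (RtoC T - Ci)%C <> 0) by (intro E; injection E; lra).
  assert (H2 : (RtoC T - - Ci)%C <> 0) by (intro E; injection E; lra).
  assert (H3 : RtoC (1 + T ^ 2) = ((RtoC T - Ci) * (RtoC T - - Ci))%C).
  { unfold Cmult, Cminus, Cplus, Copp, Ci, RtoC; simpl. f_equal; ring. }
  rewrite H3. rewrite !RtoC_mult. replace (RtoC (-2)) with (- (2))%C by (rewrite <- RtoC_opp; f_equal; ring).
  assert (H4 : (Ci * Ci)%C = (- (1))%C) by (unfold Cmult, Copp, Ci, RtoC; simpl; f_equal; ring).
  assert (Hh : (/ (RtoC T - z) - / 2 * / (RtoC T - Ci) - / 2 * / (RtoC T - - Ci))%C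
     = ((1 + z * RtoC T) / ((RtoC T - z) * ((RtoC T - Ci) * (RtoC T - - Ci))))%C).
  { assert (E3 : ((RtoC T - Ci) * (RtoC T - - Ci))%C = (RtoC T * RtoC T + 1)%C).
    { transitivity (RtoC T * RtoC T - Ci * Ci)%C; [ring|rewrite H4; ring]. }
    assert (E4 : (/ 2 * / (RtoC T - Ci) + / 2 * / (RtoC T - - Ci))%C
        = (RtoC T / ((RtoC T - Ci) * (RtoC T - - Ci)))%C).
    { field. repeat split; assumption. }
    transitivity (/ (RtoC T - z) - (/ 2 * / (RtoC T - Ci) + / 2 * / (RtoC T - - Ci)))%C; [ring|].
    rewrite E4. 
    assert (E5 : (RtoC T * RtoC T + 1)%C <> 0).
    { rewrite <- E3. apply Cmult_neq_0; assumption. }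
    rewrite E3. field. split; assumption. }
  transitivity (- (2) * RtoC sg * RtoC (weight v) * RtoC e * Ci
     * (/ (RtoC T - z) - / 2 * / (RtoC T - Ci) - / 2 * / (RtoC T - - Ci)))%C.
  - unfold Cdiv. ring.
  - rewrite Hh. field. repeat split; assumption.
Qed.

(** Add the contour shifts for p0, p1, p2 with weights 1, -1/2, -1/2. On the line
    Re w = R each integrand is (1 + 1/w) (e^(sg w) - e^(sg p)) up to O(1/R), and
    since the weights sum to 0 the terms e^(sg w), unbounded when sg = 1,
    cancel. What is left tends to minus the combination of the constants
    e^(sg p), at rate 1/R. *)
Lemma kernel_integral_re sg z p0 p1 p2 (Kb : R -> C) c :
  sg = 1 \/ sg = -1 -> cut_plane 0 z ->
  lambert_domain p0 -> zeta p0 = z -> lambert_domain p1 -> zeta p1 = Ci -> lambert_domain p2 -> zeta p2 = (- Ci)%C ->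
  (forall v, 0 <= v <= PI -> Ccont Kb v) ->
  (forall v, 0 < v < PI -> Kb v = (K z v * RtoC (exp (- (1 + sg) * vcot v)))%C) ->
  RInt (fun v => Re (c * (RtoC (2 * sg) * Ci * Kb v))%C) 0 PI
  = PI * (- 2 * Re (c * (Ci * (Cexp (sg * p0) - / 2 * Cexp (sg * p1) - / 2 * Cexp (sg * p2))))%C).
Proof.
  intros Hsg Hz D0 Z0 D1 Z1 D2 Z2 HK HKeq. assert (Hpi := PI_RGT_0).
  set (A := (Cexp (sg * p0) - / 2 * Cexp (sg * p1) - / 2 * Cexp (sg * p2))%C).
  destruct (pole_quot_far sg p0 Hsg) as [M0 [R0 [HM0 [HR0 F0]]]].
  destruct (pole_quot_far sg p1 Hsg) as [M1 [R1 [HM1 [HR1 F1]]]].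
  destruct (pole_quot_far sg p2 Hsg) as [M2 [R2 [HM2 [HR2 F2]]]].
  set (M := M0 + M1 / 2 + M2 / 2 + Cmod A).
  set (RR := Rmax R0 (Rmax R1 R2)).
  assert (L0 : R0 <= RR) by apply Rmax_l.
  assert (L1 : R1 <= RR) by (eapply Rle_trans; [apply Rmax_l|apply Rmax_r]).
  assert (L2 : R2 <= RR) by (eapply Rle_trans; [apply Rmax_r|apply Rmax_r]).
  destruct (neg_vcot_large_near_PI RR ltac:(lra)) as [b0 [Hb0 Hnear]].
  set (S := fun w => (pole_quot sg p0 w - / 2 * pole_quot sg p1 w - / 2 * pole_quot sg p2 w)%C).
  assert (HS : forall w, RR <= Re w -> Cmod (S w + A)%C <= M * / Re w).
  { intros w Hw.
    assert (hw : 0 < Re w) by lra.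
    assert (hwC : w <> 0).
    { intro E. rewrite E in hw. simpl in hw. lra. }
    assert (G0 := F0 w ltac:(lra)). assert (G1 := F1 w ltac:(lra)). assert (G2 := F2 w ltac:(lra)).
    set (E0 := (pole_quot sg p0 w - (1 + / w) * (Cexp (sg * w) - Cexp (sg * p0)))%C) in *.
    set (E1 := (pole_quot sg p1 w - (1 + / w) * (Cexp (sg * w) - Cexp (sg * p1)))%C) in *.
    set (E2 := (pole_quot sg p2 w - (1 + / w) * (Cexp (sg * w) - Cexp (sg * p2)))%C) in *.
    assert (h2 : RtoC 2 <> 0) by (intro E; injection E; lra).
    replace (S w + A)%C with (E0 + (- (/ 2 * E1) + (- (/ 2 * E2) + - (A * / w))))%C.
    2: { unfold S, A, E0, E1, E2. field. exact hwC. }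
    assert (hh : Cmod (/ 2)%C = / 2).
    { rewrite Cmod_inv by exact h2. rewrite Cmod_R, Rabs_pos_eq; lra. }
    assert (hA : Cmod (A * / w)%C <= Cmod A * / Re w).
    { rewrite Cmod_mult, Cmod_inv by exact hwC. apply Rmult_le_compat_l; [apply Cmod_ge_0|].
      apply Rinv_le_contravar; [exact hw|]. eapply Rle_trans; [apply Rle_abs|apply re_le_Cmod]. }
    eapply Rle_trans; [apply Cmod_triangle|].
    assert (T1 := Cmod_triangle (- (/ 2 * E1)) (- (/ 2 * E2) + - (A * / w))).
    assert (T2 := Cmod_triangle (- (/ 2 * E2)) (- (A * / w))).
    rewrite !Cmod_opp, !(Cmod_mult (/ 2)), hh in T1, T2. rewrite !Cmod_opp in T2.
    unfold M. unfold Rdiv in *. lra. }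
  set (f := fun v => Re (c * (RtoC (2 * sg) * Ci * Kb v))%C).
  apply (RInt_limit_PI f _ (PI * (2 * Cmod c * M)) b0); [|lra|].
  { intros v Hv. apply Ccont_scal_re. apply Ccont_mult; [apply Ccont_const|apply HK, Hv]. }
  intros b Hb. destruct (Hnear b Hb) as [HRb HRi].
  assert (Hb' : 0 < b < PI) by lra.
  assert (Hzc : cut_plane 0 Ci) by (intros [h _]; simpl in h; lra).
  assert (Hzc' : cut_plane 0 (- Ci)%C) by (intros [h _]; simpl in h; lra).
  assert (I0 := Cauchy_one_pole sg p0 b c Hsg D0 ltac:(rewrite Z0; exact Hz) Hb').
  assert (I1 := Cauchy_one_pole sg p1 b (c * / 2)%C Hsg D1 ltac:(rewrite Z1; exact Hzc) Hb').
  assert (I2 := Cauchy_one_pole sg p2 b (c * / 2)%C Hsg D2 ltac:(rewrite Z2; exact Hzc') Hb').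
  rewrite Z0 in I0. rewrite Z1 in I1. rewrite Z2 in I2.
  assert (If : is_RInt f 0 b (RInt f 0 b)).
  { apply (RInt_correct (V := R_CompleteNormedModule)).
    apply (ex_RInt_continuous (V := R_CompleteNormedModule)).
    rewrite Rmin_left, Rmax_right by lra. intros v Hv.
    apply Ccont_scal_re. apply Ccont_mult; [apply Ccont_const|apply HK; lra]. }
  set (kappa := - 2 * Re (c * (Ci * A))%C).
  assert (IS := is_RInt_minus (V := R_NormedModule) _ _ _ _ _ _
     (is_RInt_plus (V := R_NormedModule) _ _ _ _ _ _
       (is_RInt_minus (V := R_NormedModule) _ _ _ _ _ _
         (is_RInt_minus (V := R_NormedModule) _ _ _ _ _ _ I0 I1) I2) If)
     (is_RInt_const (V := R_NormedModule) 0 b kappa)).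
  set (h := fun v => Re (c * (Ci * ((S (- vcot b, v)%R + A) + (S (- vcot b, - v)%R + A))))%C).
  assert (Ih : is_RInt h 0 b (RInt f 0 b - b * kappa)).
  { replace (RInt f 0 b - b * kappa) with
      (minus (plus (minus (minus 0 0) 0) (RInt f 0 b)) (scal (b - 0) kappa)).
    2: { unfold minus, plus, opp, scal; simpl. unfold mult; simpl. 
         change (0 + - 0 + - 0 + RInt f 0 b + - ((b - 0) * kappa) = RInt f 0 b - b * kappa :> R). ring. }
    refine (is_RInt_ext _ _ _ _ _ _ IS). rewrite Rmin_left, Rmax_right by lra. intros v Hv.
    unfold h, f. rewrite (HKeq v) by lra.
    rewrite <- (jump_sum sg z v ltac:(lra) Hz).
    unfold kappa.
    set (q0 := jump sg z v). set (q1 := jump sg Ci v). set (q2 := jump sg (- Ci) v).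
    assert (ReD : forall a b : C, Re a + Re b = Re (a + b)%C) by reflexivity.
    assert (ReN : forall a : C, - Re a = Re (- a)%C) by reflexivity.
    assert (E2 : - (-2 * Re (c * (Ci * A))%C) = Re (c * (Ci * A) + c * (Ci * A))%C).
    { rewrite <- ReD. ring. }
    change (Re (c * (pole_quot sg p0 (- vcot b, v)%R * Ci + pole_quot sg p0 (- vcot b, - v)%R * Ci - q0))%C
      + - Re (c * / 2 * (pole_quot sg p1 (- vcot b, v)%R * Ci + pole_quot sg p1 (- vcot b, - v)%R * Ci - q1))%C
      + - Re (c * / 2 * (pole_quot sg p2 (- vcot b, v)%R * Ci + pole_quot sg p2 (- vcot b, - v)%R * Ci - q2))%C
      + Re (c * (q0 - / 2 * q1 - / 2 * q2))%C + - (-2 * Re (c * (Ci * A))%C)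
      = Re (c * (Ci * ((S (- vcot b, v)%R + A) + (S (- vcot b, - v)%R + A))))%C).
    rewrite E2, !ReN, !ReD. f_equal. unfold S. ring. }
  rewrite <- (is_RInt_unique _ _ _ _ Ih).
  rewrite <- HRi.
  apply Rle_trans with ((b - 0) * (2 * Cmod c * M * / (- vcot b))).
  - apply abs_RInt_le_const; [lra|eexists; exact Ih|]. intros v Hv.
    unfold h. eapply Rle_trans; [apply re_le_Cmod|].
    rewrite !Cmod_mult, Cmod_Ci, Rmult_1_l.
    assert (T := Cmod_triangle (S (- vcot b, v)%R + A) (S (- vcot b, - v)%R + A)).
    assert (T1 := HS (- vcot b, v)%R HRb). assert (T2 := HS (- vcot b, - v)%R HRb).
    simpl Re in T1, T2. assert (hc := Cmod_ge_0 c).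
    apply Rle_trans with (Cmod c * (M * / (- vcot b) + M * / (- vcot b))); [|right; ring].
    apply Rmult_le_compat_l; [exact hc|lra].
  - rewrite Rminus_0_r, <- Rmult_assoc. apply Rmult_le_compat_r.
    + left. apply Rinv_0_lt_compat. lra.
    + apply Rmult_le_compat_r; [|lra].
      assert (hc := Cmod_ge_0 c). assert (hA := Cmod_ge_0 A). unfold M.
      repeat apply Rmult_le_pos; lra.
Qed.

(** The choices c = - (sg/2) i and c = - sg/2 in [kernel_integral_re] turn the
    factor 2 sg i into 1 and - i, which select the real and imaginary parts. *)
Lemma kernel_integral sg z p0 p1 p2 :
  sg = 1 \/ sg = -1 -> cut_plane 0 z ->
  lambert_domain p0 -> zeta p0 = z -> lambert_domain p1 -> zeta p1 = Ci -> lambert_domain p2 -> zeta p2 = (- Ci)%C ->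
  is_RInt (V := C_R_NormedModule)
    (fun v => K z v * RtoC (exp (- (1 + sg) * (v * cot v))))%C 0 PI
    (RtoC (- sg * PI) * (Cexp (sg * p0) - / 2 * Cexp (sg * p1) - / 2 * Cexp (sg * p2)))%C.
Proof.
  intros Hsg Hz D0 Z0 D1 Z1 D2 Z2. assert (Hpi := PI_RGT_0).
  set (A := (Cexp (sg * p0) - / 2 * Cexp (sg * p1) - / 2 * Cexp (sg * p2))%C).
  (* for sg = 1 the integrand is [K_ext]; for sg = -1 its e^(-2 v cot v) is undone *)
  assert (HKb : exists Kb : R -> C, (forall v, 0 <= v <= PI -> Ccont Kb v) /\
     (forall v, 0 < v < PI -> Kb v = (K z v * RtoC (exp (- (1 + sg) * vcot v)))%C)).
  { destruct Hsg as [->| ->].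
    - exists (K_ext z). split; [intros; apply K_ext_continuous; assumption|].
      intros v Hv. rewrite <- K_times_exp_eq_K_ext by assumption.
      replace (- (1 + 1) * vcot v) with (- 2 * vcot v) by ring. reflexivity.
    - exists (fun v => K_ext z v * RtoC (exp_vcot_ext v ^ 2))%C. split.
      + intros v Hv. apply Ccont_mult; [apply K_ext_continuous; assumption|].
        apply Ccont_pair; [|apply continuous_const].
        apply (continuous_real_comp (fun u => u ^ 2) exp_vcot_ext); [apply exp_vcot_ext_continuous, Hv|auto_derive; trivial].
      + intros v Hv. rewrite <- K_times_exp_eq_K_ext by assumption. rewrite <- Cmult_assoc. f_equal.
        rewrite <- RtoC_mult. f_equal. unfold exp_vcot_ext. destruct Rlt_dec; [|lra].
        replace (exp (vcot v) ^ 2) with (exp (vcot v + vcot v)) by (rewrite exp_plus; ring).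
        rewrite <- exp_plus. f_equal. ring. }
  destruct HKb as [Kb [HK HKeq]].
  assert (HI := fun c => kernel_integral_re sg z p0 p1 p2 Kb c Hsg Hz D0 Z0 D1 Z1 D2 Z2 HK HKeq).
  fold A in HI.
  assert (Hs2 : sg * sg = 1) by (destruct Hsg as [->| ->]; ring).
  assert (HR : RInt (fun v => Re (Kb v)) 0 PI = - sg * PI * Re A).
  { assert (H := HI (RtoC (- sg / 2) * Ci)%C).
    rewrite (RInt_ext _ (fun v => Re (Kb v))) in H.
    - rewrite H. simpl. unfold Re, Im. field.
    - intros v _. simpl. unfold Re, Im.
      transitivity (sg * sg * fst (Kb v)); [field|rewrite Hs2; ring]. }
  assert (HM : RInt (fun v => Im (Kb v)) 0 PI = - sg * PI * Im A).
  { assert (H := HI (RtoC (- sg / 2))%C).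
    rewrite (RInt_ext _ (fun v => Im (Kb v))) in H.
    - rewrite H. simpl. unfold Re, Im. field.
    - intros v _. simpl. unfold Re, Im.
      transitivity (sg * sg * snd (Kb v)); [field|rewrite Hs2; ring]. }
  apply (is_RInt_ext (V := C_R_NormedModule) Kb).
  { rewrite Rmin_left, Rmax_right by lra. intros v Hv. rewrite HKeq, vcot_eq by exact Hv. reflexivity. }
  replace (RtoC (- sg * PI) * A)%C with ((RInt (fun v => Re (Kb v)) 0 PI, RInt (fun v => Im (Kb v)) 0 PI) : C).
  2: { rewrite HR, HM. unfold Cmult, RtoC; simpl. unfold Re, Im. f_equal; ring. }
  apply (is_RInt_fct_extend_pair (U := R_NormedModule) (V := R_NormedModule) Kb);
    apply (RInt_correct (V := R_CompleteNormedModule));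
    apply (ex_RInt_continuous (V := R_CompleteNormedModule));
    rewrite Rmin_left, Rmax_right by lra; intros v Hv; apply (HK v Hv).
Qed.

(** * Numerical enclosure of W(i), and the representations *)

Lemma nonneg_of_derive (f f' : R -> R) :
  f 0 = 0 -> (forall x, is_derive f x (f' x)) ->
  (forall x, 0 <= x -> 0 <= f' x) -> forall x, 0 <= x -> 0 <= f x.
Proof.
  intros H0 Hd Hp x Hx.
  destruct (MVT_gen f 0 x f') as [c [Hc E]].
  - intros; apply Hd.
  - intros y _. apply continuity_pt_filterlim.
    apply (ex_derive_continuous (V := R_NormedModule)). eexists; apply Hd.
  - rewrite Rmin_left, Rmax_right in Hc by lra.
    assert (h := Hp c ltac:(lra)). rewrite H0 in E. nra.
Qed.

Definition exp_trunc (n : nat) (x : R) : R := sum_f_R0 (fun k => x ^ k / INR (fact k)) n.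

Lemma exp_trunc_derive n x : is_derive (exp_trunc (S n)) x (exp_trunc n x).
Proof.
  induction n as [|n IH].
  - unfold exp_trunc; simpl. auto_derive; trivial. field.
  - apply (is_derive_ext (fun y => exp_trunc (S n) y + y ^ S (S n) / INR (fact (S (S n))))).
    { intro y. reflexivity. }
    unfold exp_trunc at 2. rewrite tech5. fold (exp_trunc n x).
    apply (is_derive_plus (V := R_NormedModule)); [exact IH|].
    assert (d : forall m c, is_derive (fun y => y ^ S m / c) x (INR (S m) * x ^ m / c)).
    { intros m c. apply (is_derive_ext (fun y => scal (/ c) (y ^ S m))).
      { intro y. unfold scal; simpl. unfold mult; simpl. apply Rmult_comm. }
      eapply is_derive_eq.
      - apply (is_derive_scal (fun y => y ^ S m)).
        apply (is_derive_pow (fun y => y) (S m) x 1). apply (is_derive_id (K := R_AbsRing)).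
      - unfold mult; simpl pred. simpl. unfold Rdiv. ring. }
    eapply is_derive_eq; [apply d|].
    rewrite (fact_simpl (S n)), mult_INR.
    assert (h1 := INR_fact_neq_0 (S n)). assert (h2 : INR (S (S n)) <> 0) by (apply not_0_INR; lia).
    match goal with |- ?l = ?r => change (@eq R l r) end.
    field. split; assumption.
Qed.

Lemma exp_trunc_0 n : exp_trunc n 0 = 1.
Proof.
  induction n as [|n IH]; unfold exp_trunc in *; [simpl; field|].
  rewrite tech5, IH. simpl pow. unfold Rdiv. ring.
Qed.

(** Each inequality is the derivative of the next one, and all of them are
    equalities at x = 0. For eps = -1 the signs alternate, which bounds
    e^(-x) on both sides. *)
Lemma exp_trunc_sign eps n x : eps = 1 \/ eps = -1 -> 0 <= x ->
  0 <= eps ^ S n * (exp (eps * x) - exp_trunc n (eps * x)).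
Proof.
  intros He. revert x. induction n as [|n IH]; intros x Hx.
  - unfold exp_trunc; simpl.
    destruct He as [->| ->].
    + assert (h := exp_ineq1_le (1 * x)). lra.
    + assert (h := exp_increasing). 
      assert (exp (-1 * x) <= 1).
      { rewrite <- exp_0. destruct Hx as [Hx| <-]; [left; apply exp_increasing; lra|right; f_equal; ring]. }
      lra.
  - revert x Hx. apply (nonneg_of_derive _ (fun x => eps ^ S n * (exp (eps * x) - exp_trunc n (eps * x)))).
    + rewrite Rmult_0_r, exp_0, exp_trunc_0. ring.
    + intro x.
      assert (d : is_derive (fun y => exp_trunc (S n) (eps * y)) x (eps * exp_trunc n (eps * x))).
      { apply (is_derive_comp (exp_trunc (S n)) (fun y => eps * y)); [apply exp_trunc_derive|].
        auto_derive; trivial. ring. }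
      assert (d' : is_derive (fun y => exp (eps * y)) x (eps * exp (eps * x))).
      { auto_derive; trivial. ring. }
      eapply is_derive_eq.
      * apply (is_derive_scal (fun y => exp (eps * y) - exp_trunc (S n) (eps * y))).
        apply (is_derive_minus (V := R_NormedModule)); [exact d'|exact d].
      * unfold minus, plus, opp; simpl.
        assert (Hs : eps * eps = 1) by (destruct He as [->| ->]; ring).
        transitivity (eps * eps * (eps * eps ^ n * (exp (eps * x) - exp_trunc n (eps * x)))); [ring|].
        rewrite Hs. ring.
    + intros x Hx. apply IH, Hx.
Qed.

Lemma cos_lo a : 0 <= a <= 1 ->
  1 - a^2/2 + a^4/24 - a^6/720 + a^8/40320 - a^10/3628800 <= cos a.
Proof.
  intro Ha. assert (h := PI2_3_2).
  destruct (pre_cos_bound a 2 ltac:(lra) ltac:(lra)) as [H _].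
  eapply Rle_trans; [|exact H]. right.
  unfold cos_approx, cos_term. cbn [sum_f_R0 Nat.mul Nat.add].
  rewrite !fact_simpl, !mult_INR. simpl fact. simpl INR. simpl pow. field.
Qed.

Lemma cos_hi a : 0 <= a <= 1 ->
  cos a <= 1 - a^2/2 + a^4/24 - a^6/720 + a^8/40320 - a^10/3628800 + a^12/479001600.
Proof.
  intro Ha. assert (h := PI2_3_2).
  destruct (pre_cos_bound a 2 ltac:(lra) ltac:(lra)) as [_ H].
  eapply Rle_trans; [exact H|]. right.
  unfold cos_approx, cos_term. cbn [sum_f_R0 Nat.mul Nat.add].
  rewrite !fact_simpl, !mult_INR. simpl fact. simpl INR. simpl pow. field.
Qed.

Lemma sin_hi a : 0 <= a <= 1 ->
  sin a <= a - a^3/6 + a^5/120 - a^7/5040 + a^9/362880 - a^11/39916800 + a^13/6227020800.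
Proof.
  intro Ha.
  destruct (pre_sin_bound a 2 ltac:(lra) ltac:(lra)) as [_ H].
  eapply Rle_trans; [exact H|]. right.
  unfold sin_approx, sin_term. cbn [sum_f_R0 Nat.mul Nat.add].
  rewrite !fact_simpl, !mult_INR. simpl fact. simpl INR. simpl pow. field.
Qed.

Lemma sin_lo a : 0 <= a <= 1 ->
  a - a^3/6 + a^5/120 - a^7/5040 + a^9/362880 - a^11/39916800 <= sin a.
Proof.
  intro Ha.
  destruct (pre_sin_bound a 2 ltac:(lra) ltac:(lra)) as [H _].
  eapply Rle_trans; [|exact H]. right.
  unfold sin_approx, sin_term. cbn [sum_f_R0 Nat.mul Nat.add].
  rewrite !fact_simpl, !mult_INR. simpl fact. simpl INR. simpl pow. field.
Qed.

Lemma exp_trunc_9 x : exp_trunc 9 x =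
  1 + x + x^2/2 + x^3/6 + x^4/24 + x^5/120 + x^6/720 + x^7/5040 + x^8/40320 + x^9/362880.
Proof.
  unfold exp_trunc. cbn [sum_f_R0].
  rewrite !fact_simpl, !mult_INR. simpl fact. simpl INR. simpl pow. field.
Qed.

Lemma W_Ci_test_left : 0.5764127 * exp (0.5764127 * sin 0.5764127 / cos 0.5764127) <= cos 0.5764127.
Proof.
  set (v := 0.5764127).
  assert (Hv : 0 <= v <= 1) by (unfold v; lra).
  assert (hc := cos_lo v Hv). assert (hs := sin_hi v Hv).
  assert (hcn : 0.8384231 <= cos v) by (unfold v in *; lra).
  assert (hu : v * sin v / cos v <= 0.374698987).
  { apply Rle_div_l; [lra|]. unfold v in *; lra. }
  assert (he := exp_trunc_sign (-1) 9 0.374698987 ltac:(auto) ltac:(lra)).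
  replace ((-1) ^ 10) with 1 in he by ring.
  rewrite exp_trunc_9 in he.
  (* 0.374698987 is v tan v rounded up; the two sides differ by about 7e-8 *)
  set (E := 0.374698987) in *.
  replace (-1 * E) with (- E) in he by ring.
  assert (hee : exp (v * sin v / cos v) <= exp E).
  { destruct hu as [hu|hu]; [left; apply exp_increasing, hu|right; f_equal; exact hu]. }
  assert (h1 : exp E * exp (- E) = 1) by (rewrite <- exp_plus, Rplus_opp_r; apply exp_0).
  assert (h2 := exp_pos E).
  assert (hm : v <= cos v * exp (- E)).
  { apply Rle_trans with ((1 - v^2/2 + v^4/24 - v^6/720 + v^8/40320 - v^10/3628800) * exp (- E)).
    - unfold v, E in *; lra.
    - apply Rmult_le_compat_r; [left; apply exp_pos|exact hc]. }
  apply Rle_trans with (v * exp E).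
  - apply Rmult_le_compat_l; [lra|exact hee].
  - apply Rle_trans with (cos v * exp (- E) * exp E); [apply Rmult_le_compat_r; lra|].
    right. rewrite Rmult_assoc, (Rmult_comm (exp (- E))), h1. ring.
Qed.

Lemma W_Ci_test_right : cos 0.5764128 < 0.5764128 * exp (0.5764128 * sin 0.5764128 / cos 0.5764128).
Proof.
  set (v := 0.5764128).
  assert (Hv : 0 <= v <= 1) by (unfold v; lra).
  assert (hc := cos_hi v Hv). assert (hs := sin_lo v Hv). assert (hcl := cos_lo v Hv).
  assert (hcp : 0.8 <= cos v) by (unfold v in *; lra).
  assert (hu : 0.374699133 <= v * sin v / cos v).
  { apply (proj1 (Rle_div_r 0.374699133 (v * sin v) (cos v) ltac:(lra))). unfold v in *; lra. }
  assert (he := exp_trunc_sign 1 9 0.374699133 ltac:(auto) ltac:(lra)).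
  rewrite exp_trunc_9, pow1, !Rmult_1_l in he.
  (* 0.374699133 is v tan v rounded down; the two sides differ by about 2e-7 *)
  set (E := 0.374699133) in *.
  assert (hee : exp E <= exp (v * sin v / cos v)).
  { destruct hu as [hu|hu]; [left; apply exp_increasing, hu|right; f_equal; exact hu]. }
  apply Rlt_le_trans with (v * exp E).
  - unfold v, E in *; lra.
  - apply Rmult_le_compat_l; [lra|exact hee].
Qed.

Lemma vtan_incr x y : 0 < x <= y -> y < PI / 2 -> x * sin x / cos x <= y * sin y / cos y.
Proof.
  intros Hx Hy.
  assert (cx : 0 < cos x) by (apply cos_gt_0; lra).
  assert (cy : 0 < cos y) by (apply cos_gt_0; lra).
  assert (cxy : cos y <= cos x).
  { destruct (proj2 Hx) as [h| ->]; [|lra]. left. apply cos_decreasing_1; lra. }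
  assert (sxy : sin x <= sin y).
  { destruct (proj2 Hx) as [h| ->]; [|lra]. left. apply sin_increasing_1; lra. }
  assert (sx : 0 < sin x) by (apply sin_gt_0; lra).
  unfold Rdiv. apply Rmult_le_compat; [nra| |nra|apply Rinv_le_contravar; assumption].
  left. apply Rinv_0_lt_compat, cx.
Qed.

(** For w = u + i v the real part of w e^w = i gives u = v tan v, and then the
    imaginary part gives v e^u = cos v. As v e^(v tan v) increases and cos v
    decreases on (0, PI/2), comparing them at two points encloses v. Moreover
    Re (e^w) = e^u cos v = cos^2 v / v. *)
Lemma W_Ci_bounds w : lambert_domain w -> zeta w = Ci ->
  0.5764127 <= Im w < 0.5764128 /\ 1.21953 <= Re (Cexp w) < 1.21954.
Proof.
  intros D E. destruct w as [u v].
  assert (Hpi := PI_RGT_0). assert (Hpi2 := PI2_3_2).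
  assert (Hi := zeta_im u v). assert (Hr := zeta_re u v). rewrite E in Hi, Hr. simpl in Hi, Hr.
  assert (Hc : cut_plane 0 (zeta (u, v))) by (rewrite E; intros [h _]; simpl in h; lra).
  destruct (lambert_domain_cases _ D Hc) as [[Hv _]|[[_ [_ h]]|[_ h]]];
    [|rewrite E in h; simpl in h; lra|rewrite E in h; simpl in h; lra].
  destruct D as [D1 D2]. simpl in *.
  assert (He := exp_pos u).
  assert (Hr' : u * cos v = v * sin v).
  { symmetry in Hr. apply Rmult_integral in Hr. destruct Hr; lra. }
  assert (Hs : 0 < sin v) by (apply sin_gt_0; lra).
  assert (Hcos : 0 < cos v).
  { destruct (Rlt_dec 0 (cos v)) as [h|h]; [exact h|exfalso].
    assert (Hvc : - vcot v >= 0).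
    { rewrite vcot_eq by lra. unfold cot. assert (0 < / sin v) by (apply Rinv_0_lt_compat; exact Hs).
      assert (0 <= v * (- cos v) * / sin v) by (repeat apply Rmult_le_pos; lra).
      unfold Rdiv. lra. }
    assert (0 < v * sin v) by (apply Rmult_lt_0_compat; lra). nra. }
  assert (Hv2 : v < PI / 2).
  { apply Rnot_le_lt. intro h. assert (g := cos_le_0 v h ltac:(lra)). lra. }
  assert (Hu : u = v * sin v / cos v) by (rewrite <- Hr'; field; lra).
  assert (Hm : exp u * v = cos v).
  { assert (g : exp u * (u * cos v * sin v + v * (cos v * cos v)) = cos v).
    { transitivity (exp u * (u * sin v + v * cos v) * cos v); [ring|rewrite <- Hi; ring]. }
    rewrite Hr' in g. assert (t := sin2_cos2 v). unfold Rsqr in t.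
    rewrite <- g. transitivity (exp u * (v * (sin v * sin v + cos v * cos v))); [rewrite t; ring|ring]. }
  assert (B : 0.5764127 <= v < 0.5764128).
  { split.
    - apply Rnot_lt_le. intro h.
      assert (g1 := vtan_incr v 0.5764127 ltac:(lra) ltac:(lra)). rewrite <- Hu in g1.
      assert (g2 := W_Ci_test_left).
      assert (g3 : cos 0.5764127 < cos v) by (apply cos_decreasing_1; lra).
      set (u1 := 0.5764127 * sin 0.5764127 / cos 0.5764127) in *.
      assert (g4 : exp u <= exp u1).
      { destruct g1 as [g1| ->]; [left; apply exp_increasing, g1|right; reflexivity]. }
      assert (g5 : exp u * v <= exp u1 * 0.5764127) by (apply Rmult_le_compat; lra). lra.
    - apply Rnot_le_lt. intro h.
      assert (g1 := vtan_incr 0.5764128 v ltac:(lra) ltac:(lra)). rewrite <- Hu in g1.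
      assert (g2 := W_Ci_test_right).
      assert (g3 : cos v <= cos 0.5764128).
      { destruct h as [h| ->]; [left; apply cos_decreasing_1; lra|lra]. }
      set (u1 := 0.5764128 * sin 0.5764128 / cos 0.5764128) in *.
      assert (g4 : exp u1 <= exp u).
      { destruct g1 as [g1| ->]; [left; apply exp_increasing, g1|right; reflexivity]. }
      assert (g0 := exp_pos u1).
      assert (g5 : exp u1 * 0.5764128 <= exp u * v) by (apply Rmult_le_compat; lra). lra. }
  split; [exact B|].
  assert (Hx : exp u * cos v = cos v * cos v / v).
  { rewrite <- Hm at 2. field. lra. }
  rewrite Hx.
  assert (c1 : cos v <= 0.8384232).
  { apply Rle_trans with (cos 0.5764127).
    - destruct (proj1 B) as [h| <-]; [left; apply cos_decreasing_1; lra|lra].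
    - assert (g := cos_hi 0.5764127 ltac:(lra)). lra. }
  assert (c2 : 0.8384231 <= cos v).
  { apply Rle_trans with (cos 0.5764128).
    - assert (g := cos_lo 0.5764128 ltac:(lra)). lra.
    - left; apply cos_decreasing_1; lra. }
  split.
  - apply (proj1 (Rle_div_r 1.21953 (cos v * cos v) v ltac:(lra))). nra.
  - apply (proj2 (Rlt_div_l (cos v * cos v) 1.21954 v ltac:(lra))). nra.
Qed.

Theorem theorem7p4 (W : C -> C) (HW : principal_LambertW W) :
  let beta0 : R := Re (W Ci / Ci)%C in
  let eta0 : R := Re (Ci / W Ci)%C in
  (beta0 = Im (W Ci) /\
   0.5764127 <= beta0 < 0.5764128 /\
   1.21953 <= eta0 < 1.21954) /\
  forall z : C, z <> RtoC 0 -> cut_plane 0 z ->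
    let F : R -> C := fun v => K z v in
    let G : R -> C := fun v => (K z v * RtoC (exp (- 2 * v * cot v)))%C in
    (ex_RInt (V := C_R_NormedModule) F 0 PI /\
     (W z / z = beta0
        + RtoC (1 / PI)%R * RInt (V := C_R_CompleteNormedModule) F 0 PI)%C) /\
    (ex_RInt (V := C_R_NormedModule) G 0 PI /\
     (z / W z = eta0
        - RtoC (1 / PI)%R * RInt (V := C_R_CompleteNormedModule) G 0 PI)%C).
Proof.
  apply principal_like in HW. intros beta0 eta0. assert (Hpi := PI_RGT_0).
  assert (Hexp : forall z w : C, z <> RtoC 0 -> zeta w = z ->
     (w / z)%C = Cexp (RtoC (-1) * w)%C /\ (z / w)%C = Cexp (RtoC 1 * w)%C).
  { intros z w Hz E. rewrite zeta_eq in E. assert (he := Cexp_neq_0 w).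
    assert (hw : w <> RtoC 0) by (intros ->; apply Hz; rewrite <- E; ring).
    split.
    - replace (RtoC (-1) * w)%C with (- w)%C by (replace (RtoC (-1)) with (- (1))%C; [ring|rewrite <- RtoC_opp; f_equal; ring]).
      rewrite Cexp_opp, <- E. field. split; assumption.
    - rewrite Cmult_1_l, <- E. field. exact hw. }
  assert (Hci : cut_plane 0 Ci) by (intros [h _]; simpl in h; lra).
  assert (Hci0 : Ci <> RtoC 0) by (intro E; injection E; lra).
  destruct (LambertW_lambert_domain W Ci HW Hci) as [Zi Di].
  destruct (Hexp Ci (W Ci) Hci0 Zi) as [Eb Ee].
  split.
  { assert (Hb : beta0 = Im (W Ci)).
    { unfold beta0. rewrite <- (Ropp_involutive (Im (W Ci))). unfold Cdiv. rewrite Ci_inv. simpl.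
      unfold Re, Im. ring. }
    destruct (W_Ci_bounds (W Ci) Di Zi) as [B1 B2].
    rewrite Cmult_1_l in Ee.
    split; [exact Hb|]. split; [rewrite Hb; exact B1|]. unfold eta0. rewrite Ee. exact B2. }
  intros z Hz Hc F G.
  destruct (LambertW_lambert_domain W z HW Hc) as [Zz Dz].
  destruct (Hexp z (W z) Hz Zz) as [Ez1 Ez2].
  assert (Dc : lambert_domain (Cconj (W Ci))).
  { destruct Di as [d1 d2]. split; simpl; unfold Im, Re in *; [lra|]. rewrite vcot_even. exact d2. }
  assert (Zc : zeta (Cconj (W Ci)) = (- Ci)%C).
  { rewrite zeta_conj, Zi. unfold Cconj, Ci, Copp; simpl. f_equal; ring. }
  (* averaging over W(i) and its conjugate produces the constants beta0 and eta0 *)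
  assert (Avg : forall sg : R, (/ 2 * Cexp (RtoC sg * W Ci) + / 2 * Cexp (RtoC sg * Cconj (W Ci)))%C
     = RtoC (Re (Cexp (RtoC sg * W Ci)%C))).
  { intro sg. replace (RtoC sg * Cconj (W Ci))%C with (Cconj (RtoC sg * W Ci)%C).
    2: { rewrite Cmult_conj. f_equal. unfold Cconj, RtoC; simpl. f_equal; ring. }
    rewrite Cexp_conj. set (q := Cexp _). destruct q as [a b].
    rewrite <- RtoC_inv by lra.
    unfold Cconj, Cmult, Cplus, RtoC; simpl. f_equal; field. }
  assert (HpiC : RtoC PI <> RtoC 0) by (intro E; injection E; lra).
  assert (Hp : RtoC (1 / PI) = (/ RtoC PI)%C).
  { unfold Rdiv. rewrite Rmult_1_l. apply RtoC_inv. lra. }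
  assert (I1 := kernel_integral (-1) z (W z) (W Ci) (Cconj (W Ci)) ltac:(auto) Hc Dz Zz Di Zi Dc Zc).
  assert (I2 := kernel_integral 1 z (W z) (W Ci) (Cconj (W Ci)) ltac:(auto) Hc Dz Zz Di Zi Dc Zc).
  rewrite <- Ez1 in I1. rewrite <- Ez2 in I2.
  split.
  - assert (I : is_RInt (V := C_R_NormedModule) F 0 PI
       (RtoC (- -1 * PI) * (W z / z - / 2 * Cexp (RtoC (-1) * W Ci) - / 2 * Cexp (RtoC (-1) * Cconj (W Ci))))%C).
    { refine (is_RInt_ext _ _ _ _ _ _ I1). intros v _. unfold F.
      replace (- (1 + -1) * (v * cot v)) with 0 by ring. rewrite exp_0. apply Cmult_1_r. }
    split; [eexists; exact I|].
    rewrite (is_RInt_unique (V := C_R_CompleteNormedModule) F 0 PI _ I).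
    unfold beta0. rewrite Eb, <- Avg, Hp.
    replace (- -1 * PI) with PI by ring. field. split; assumption.
  - assert (I : is_RInt (V := C_R_NormedModule) G 0 PI
       (RtoC (- 1 * PI) * (z / W z - / 2 * Cexp (RtoC 1 * W Ci) - / 2 * Cexp (RtoC 1 * Cconj (W Ci))))%C).
    { refine (is_RInt_ext _ _ _ _ _ _ I2). intros v _. unfold G.
      replace (- (1 + 1) * (v * cot v)) with (- 2 * v * cot v) by ring. reflexivity. }
    split; [eexists; exact I|].
    rewrite (is_RInt_unique (V := C_R_CompleteNormedModule) G 0 PI _ I).
    unfold eta0. rewrite Ee, <- Avg, Hp.
    replace (RtoC (- 1 * PI)) with (- RtoC PI)%C by (rewrite <- RtoC_opp; f_equal; ring).
    field. split; [|exact HpiC].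
    intro E. rewrite zeta_eq, E, Cmult_0_l in Zz. apply Hz. symmetry. exact Zz.
Qed.
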